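(* Let $n\ge 1$ and let $A\in\mathbb{T}^{n\times n}$ be a matrix over the max-plus semiring. For each rank function $\mathrm{rk}_\star$ among the tropical rank, symmetrized rank, Gondran–Minoux row rank, Gondran–Minoux column rank, Kapranov rank, Schein/Barvinok rank, row rank and column rank, consider $$\min_{B\in\overline{\pi\langle A\rangle}} \mathrm{rk}_\star(B),$$ where $\overline{\pi\langle A\rangle}$ is the closure of the projective semigroup generated by $A$. This value is the same for all of these notions of rank. Denote the common value by $\mathrm{urk}(A)$ (the ultimate rank of $A$). Furthermore, $$\mathrm{urk}(A)=\sum_{C\in\mathfrak{C}}\mathrm{cyc}(C),$$ where $\mathfrak{C}$ is the set of strongly connected components of the critical graph $\mathcal{G}_c(A)$ and $\mathrm{cyc}(C)$ is the cyclicity of $C$.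
   Context: Max-plus semiring: $\mathbb{T}=\mathbb{R}\cup\{-\infty\}$ with ''addition'' $x\vee y=\max(x,y)$ and ''multiplication'' $x+y$. Matrix product: $(AB)_{ij}=(A\odot B)_{ij}=\max_k(A_{ik}+B_{kj})$; powers $A^k$ are with respect to this product; $(\lambda\odot A)_{ij}=\lambda+A_{ij}$. The null matrix has all entries $-\infty$. $\vee$ of vectors is entrywise; an empty $\vee$ is $-\infty$. Projective classes: two matrices $A,B$ of the same size are equivalent if $B=\lambda\odot A$ for some $\lambda\in\mathbb{R}$; $\pi$ is the quotient map $\mathbb{T}^{n\times n}\to\mathbb{PT}^{n\times n}$. $\pi\langle A\rangle=\{\pi(A^k): k\ge 1\}$ and $\overline{\pi\langle A\rangle}$ is its closure. Convergence of classes of non-null matrices means convergence of suitably scaled representatives to a non-null matrix (quotient topology on classes of non-null matrices, $\mathbb{T}$ having its usual topology in which $x_k\to-\infty$ is allowed); the class of the null matrix is an isolated point. All ranks below are invariant under equivalence, so they are defined on classes. Graphs: $\mathcal{G}(A)$ is the weighted digraph on $\{1,\dots,n\}$ with an arc $(i,j)$ of weight $A_{ij}$ whenever $A_{ij}\ne-\infty$. A circuit is a closed walk (of length at least 1). $\rho(A)=\max_{j\le n}\max_{i_1,\dots,i_j}\frac{A_{i_1i_2}+A_{i_2i_3}+\cdots+A_{i_ji_1}}{j}$ is the maximal mean weight of circuits of $\mathcal{G}(A)$ ($-\infty$ if $\mathcal{G}(A)$ is acyclic). A circuit is critical if its mean weight is $\rho(A)$; the critical graph $\mathcal{G}_c(A)$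 is the union (nodes and arcs) of all critical circuits of $\mathcal{G}(A)$, empty if $\mathcal{G}(A)$ is acyclic. The cyclicity of a strongly connected graph is the gcd of the lengths of its circuits. Ranks of $A\in\mathbb{T}^{n\times m}$ (all ranks of a null matrix are $0$ by convention): - Permanent of a square matrix $B\in\mathbb{T}^{r\times r}$: $\mathrm{per}(B)=\max_{\sigma\in\mathfrak{S}_r}(B_{1\sigma(1)}+\cdots+B_{r\sigma(r)})$. $B$ is singular if $B=(-\infty)\in\mathbb{T}^{1\times1}$ or at least two different permutations attain this maximum; otherwise it is non-singular. Tropical rank: the maximal $r$ such that $A$ has an $r\times r$ non-singular submatrix. - Symmetrized rank: the maximal $r$ such that $A$ has an $r\times r$ submatrix $B$ with $\det^+(B)\ne\det^-(B)$, where $\det^+$ (resp. $\det^-$) is defined as the permanent but restricted to even (resp. odd) permutations. - Gondran–Minoux row (column) rank: the maximal number of rows (columns) of $A$ forming a linearly independent family, where $\mathbf{x}_1,\dots,\mathbf{x}_r$ is linearly independent if for all disjoint $I,J\subset\{1,\dots,r\}$ and all $\alpha_i\in\mathbb{T}$ ($i\in I\cup J$), not all $-\infty$, $\bigvee_{i\in I}(\alpha_i\odot\mathbf{x}_i)\ne\bigvee_{j\in J}(\alpha_j\odot\mathbf{x}_j)$. - Kapranov rank: the smallest rank of a matrix $F=(F_{ij})$ over the field $K$ of generalized power series $\sum_a c_a t^a$ with complex coefficients, real exponents and well-ordered support, such that $-\mathrm{ord}(F_{ij})=A_{ij}$ for all $i,j$, where $\mathrm{ord}$ is the lowest exponent and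 $\mathrm{ord}(0)=+\infty$. - Schein/Barvinok rank: the minimal $r$ such that $A=BC$ for some $B\in\mathbb{T}^{n\times r}$, $C\in\mathbb{T}^{r\times m}$. - Row (column) rank: the weak dimension of the tropical convex hull of the rows (columns) of $A$. The tropical convex hull of a finite family $\mathcal{I}$ of vectors is $\{\bigvee_{\mathbf{s}\in\mathcal{I}}(\alpha_{\mathbf{s}}\odot\mathbf{s}):\alpha_{\mathbf{s}}\in\mathbb{T}\}$; its weak dimension is the cardinality of its (unique up to tropical scaling) inclusion-minimal generating set. *)

(* Defs.v *)
From HB Require Import structures.
From mathcomp Require Import all_boot all_order all_algebra all_fingroup.
From mathcomp Require Import finmap.
From mathcomp Require Import all_classical all_reals topology ereal.
From mathcomp Require Import complex.

Set Implicit Arguments.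
Unset Strict Implicit.
Unset Printing Implicit Defensive.

Import Order.TTheory GRing.Theory Num.Theory.

Local Open Scope classical_set_scope.
Local Open Scope ring_scope.

Section WellOrdered.
Context {R : realType}.
Implicit Types (S T X : set R) (a b x y : R).

Definition well_ordered S :=
  forall X, X `<=` S -> X !=set0 -> exists2 x, X x & lbound X x.

Lemma well_ordered_sub S T : S `<=` T -> well_ordered T -> well_ordered S.
Proof. by move=> ST woT X XS; apply: woT; exact: subset_trans ST. Qed.

Lemma well_ordered1 a : well_ordered [set a].
Proof.
by move=> X Xa [x Xx]; exists x => // y Xy; rewrite (Xa x Xx) (Xa y Xy).
Qed.

Lemma well_orderedU S T :
  well_ordered S -> well_ordered T -> well_ordered (S `|` T).
Proof.
move=> woS woT X XST X0.
have [[a XSa]|XS0] := pselect (X `&` S !=set0); last first.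
  apply: woT => // x Xx; have [Sx|//] := XST x Xx.
  by case: XS0; exists x.
have [[b XTb]|XT0] := pselect (X `&` T !=set0); last first.
  apply: woS => // x Xx; have [//|Tx] := XST x Xx.
  by case: XT0; exists x.
have [x [Xx Sx] minx] := woS (X `&` S) (@subIsetr _ _ _) (ex_intro _ a XSa).
have [y [Xy Ty] miny] := woT (X `&` T) (@subIsetr _ _ _) (ex_intro _ b XTb).
exists (Num.min x y).
  by case: (leP x y).
move=> z Xz; have [Sz|Tz] := XST z Xz.
  by rewrite ge_min minx.
by rewrite ge_min (miny z) ?orbT.
Qed.

Lemma well_ordered_ind S (P : R -> Prop) : well_ordered S ->
  (forall a, S a -> (forall b, S b -> b < a -> P b) -> P a) ->
  forall a, S a -> P a.
Proof.
move=> woS IH a Sa; apply: contrapT => nPa.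
have [|b [Sb nPb] minb] := woS [set x | S x /\ ~ P x] (fun _ => @proj1 _ _).
  by exists a.
apply: nPb; apply: IH => // c Sc cb; apply: contrapT => nPc.
by have := minb c (conj Sc nPc); rewrite leNgt cb.
Qed.

Lemma well_orderedD S T : well_ordered S -> well_ordered T ->
  well_ordered [set a + b | a in S & b in T].
Proof.
move=> woS woT X0 X0ST [x0 X0x0].
pose P t := forall X s, X `<=` [set a + b | a in S & b in T] ->
  S s -> X (s + t) -> (forall a b, S a -> T b -> X (a + b) -> s <= a) ->
  exists2 x, X x & lbound X x.
have key : forall t, T t -> P t.
  apply: (well_ordered_ind woT) => t Tt IH X s XST Ss Xst smin.
  have [stmin|] := pselect (lbound X (s + t)); first by exists (s + t).
  move=> /existsNP[y /not_implyP[Xy /negP]]; rewrite -ltNge => yst.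
  pose X' := X `&` [set z | z <= y].
  pose SX := [set a | S a /\ exists2 b, T b & X' (a + b)].
  have [|s1 [Ss1 [t1 Tt1 [Xst1 st1y]]] s1min] := woS SX (fun _ => @proj1 _ _).
    have [a Sa [b Tb abE]] := XST y Xy.
    exists a; split=> //; exists b => //.
    by split; rewrite abE//=.
  have t1t : t1 < t.
    have := smin _ _ Ss1 Tt1 Xst1 => ss1.
    rewrite -(ltrD2l s); apply: le_lt_trans yst.
    by apply: le_trans st1y; rewrite lerD2r.
  have [|||x [Xx xy] xmin] := IH t1 Tt1 t1t X' s1 _ Ss1 _ _.
  - by move=> z [Xz _]; exact: XST.
  - by [].
  - by move=> a b Sa Tb ab; apply: s1min; split=> //; exists b.
  exists x => // z Xz; have [zy|/ltW yz] := leP z y; first exact: xmin.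
  exact: le_trans yz.
pose SX := [set a | S a /\ exists2 b, T b & X0 (a + b)].
have [|s [Ss [t Tt Xst]] smin] := woS SX (fun _ => @proj1 _ _).
  have [a Sa [b Tb abE]] := X0ST x0 X0x0.
  by exists a; split=> //; exists b => //; rewrite abE.
apply: (key t Tt X0 s) => // a b Sa Tb ab.
by apply: smin; split=> //; exists b.
Qed.

Lemma well_ordered_finite S T a : well_ordered S -> well_ordered T ->
  finite_set [set b | S b /\ T (a - b)].
Proof.
move=> woS woT; set D := (X in finite_set X).
have woD : well_ordered D by apply: well_ordered_sub woS => x [].
have maxD X : X `<=` D -> X !=set0 -> exists2 x, X x & ubound X x.
  move=> XD [x Xx].
  have [||y [Xy Ty] miny] := woT [set y | X (a - y) /\ T y].
  - by move=> y [].
  - by exists (a - x); split; rewrite ?subKr//; have [] := XD _ Xx.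
  exists (a - y) => // z Xz; rewrite lerBrDl -lerBrDr.
  by apply: miny; split; rewrite ?subKr//; have [] := XD _ Xz.
have fin : forall b, D b -> finite_set (D `&` [set x | x <= b]).
  apply: (well_ordered_ind woD) => b Db IH.
  have [[c Dc]|D0] := pselect ((D `&` [set x | x < b]) !=set0); last first.
    apply: (sub_finite_set _ (finite_set1 b)) => x [Dx].
    rewrite /= le_eqVlt => /orP[/eqP//|xb].
    by case: D0; exists x.
  have [|m [Dm mb] mmax] := maxD (D `&` [set x | x < b]) (@subIsetl _ _ _).
    by exists c.
  apply: (@sub_finite_set _ _ ((D `&` [set x | x <= m]) `|` [set b])).
    move=> x [Dx]; rewrite /= le_eqVlt => /orP[/eqP ->|xb]; first by right.
    by left; split=> //; apply: mmax.
  by rewrite finite_setU; split; [exact: IH|exact: finite_set1].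
have [/eqP ->//|/set0P D0] := boolP (D == set0).
have [m Dm mmax] := maxD D (@subset_refl _ _) D0.
by apply: sub_finite_set (fin m Dm) => x Dx; split => //; apply: mmax.
Qed.

End WellOrdered.
Arguments well_ordered1 {R} a X _ _.

(* Generalized power series \sum_a f_a t^a with complex coefficients, real
   exponents and well-ordered support. *)
Record hahn (R : realType) := Hahn {
  hcoef :> R -> R[i];
  hahnP : well_ordered [set a | hcoef a != 0] }.
Arguments hahnP {R} h X _ _.

HB.instance Definition _ (R : realType) := gen_eqMixin (hahn R).
HB.instance Definition _ (R : realType) := gen_choiceMixin (hahn R).

Section Hahn.
Context {R : realType}.
Implicit Types (f g h : hahn R) (a b c : R).

Lemma hahn_ext f g : f =1 g -> f = g.
Proof.
case: f g => [f fP] [g gP] /= /funext fg; case: g / fg in gP *.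
by rewrite (Prop_irrelevance fP gP).
Qed.

Lemma hmono_subproof (x : R[i]) a :
  well_ordered [set b | (if b == a then x else 0) != 0].
Proof.
apply: (well_ordered_sub _ (well_ordered1 a)) => b /=.
by case: (b =P a) => //; rewrite eqxx.
Qed.

(* The monomial x t^a *)
Definition hmono x a := Hahn (@hmono_subproof x a).

Lemma hadd_subproof f g : well_ordered [set a | f a + g a != 0].
Proof.
apply: (well_ordered_sub _ (well_orderedU (hahnP f) (hahnP g))) => a /=.
by have [->|f0 _] := eqVneq (f a) 0; [rewrite add0r; right|left].
Qed.

Lemma hopp_subproof f : well_ordered [set a | - f a != 0].
Proof. by apply: (well_ordered_sub _ (hahnP f)) => a /=; rewrite oppr_eq0. Qed.

Definition hadd f g := Hahn (@hadd_subproof f g).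
Definition hopp f := Hahn (@hopp_subproof f).

Fact haddA : associative hadd.
Proof. by move=> f g h; apply: hahn_ext => a /=; rewrite addrA. Qed.
Fact haddC : commutative hadd.
Proof. by move=> f g; apply: hahn_ext => a /=; rewrite addrC. Qed.
Fact hadd0 : left_id (hmono 0 0) hadd.
Proof. by move=> f; apply: hahn_ext => a /=; rewrite if_same add0r. Qed.
Fact haddN : left_inverse (hmono 0 0) hopp hadd.
Proof. by move=> f; apply: hahn_ext => a /=; rewrite if_same addNr. Qed.

HB.instance Definition _ :=
  GRing.isZmodule.Build (hahn R) haddA haddC hadd0 haddN.

Lemma hcoef0 a : (0 : hahn R) a = 0.
Proof. by rewrite /= if_same. Qed.

Lemma hcoefD f g a : (f + g) a = f a + g a.
Proof. by []. Qed.

Lemma hcoefN f a : (- f) a = - f a.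
Proof. by []. Qed.

Lemma hcoefB f g a : (f - g) a = f a - g a.
Proof. by []. Qed.

Lemma hcoef_sum I (r : seq I) (P : pred I) (F : I -> hahn R) a :
  (\sum_(i <- r | P i) F i) a = \sum_(i <- r | P i) F i a.
Proof.
by elim/big_rec2: _ => [|i x y _ <-]; [exact: hcoef0|].
Qed.

(* The sum ranges over a finite set by [well_ordered_finite]. *)
Definition hconv f g a : R[i] := \sum_(b \in [set: R]) f b * g (a - b).

Lemma hconv_finite f g a : finite_set [set b | f b * g (a - b) != 0].
Proof.
apply: sub_finite_set (well_ordered_finite a (hahnP f) (hahnP g)) => b /=.
by rewrite mulf_eq0 negb_or => /andP.
Qed.

Lemma hconv_seq f g a (s : seq R) : uniq s ->
  (forall b, f b != 0 -> g (a - b) != 0 -> b \in s) ->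
  hconv f g a = \sum_(b <- s) f b * g (a - b).
Proof.
move=> us sE; rewrite /hconv fsbig_supp; apply: fsbig_fwiden => //.
- move=> b [_ /= /eqP]; rewrite mulf_eq0 negb_or => /andP[f0 g0].
  exact: sE.
- move=> b [_] /= /not_andP[//|]; rewrite notK.
  by move=> ->.
Qed.

Lemma hconv_neq0 f g a : hconv f g a != 0 ->
  exists b, f b != 0 /\ g (a - b) != 0.
Proof.
move=> fg0; apply: contrapT => nex; case/eqP: fg0.
rewrite (@hconv_seq f g a [::])// ?big_nil// => b fb gb.
by case: nex; exists b.
Qed.

Lemma hmul_subproof f g : well_ordered [set a | hconv f g a != 0].
Proof.
apply: (well_ordered_sub _ (well_orderedD (hahnP f) (hahnP g))) => a /=.
move=> /hconv_neq0[b [fb gb]]; exists b => //; exists (a - b) => //.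
by rewrite addrC subrK.
Qed.

Definition hmul f g := Hahn (@hmul_subproof f g).

Lemma finite_enum (D : set R) : finite_set D ->
  exists2 s : seq R, uniq s & forall b, D b -> b \in s.
Proof.
by move=> /finite_fsetP[s ->]; exists s; [exact: fset_uniq|].
Qed.

Fact hmulC : commutative hmul.
Proof.
move=> f g; apply: hahn_ext => a /=.
have [s us sP] := finite_enum (well_ordered_finite a (hahnP f) (hahnP g)).
rewrite (@hconv_seq f g a s)//; last by move=> b fb gb; apply: sP.
rewrite (@hconv_seq g f a (map (fun b => a - b) s)).
- rewrite big_map; apply: eq_bigr => b _.
  by rewrite subKr mulrC.
- by rewrite map_inj_uniq// => x y /addrI /oppr_inj.
- move=> b gb fb; apply/mapP; exists (a - b); rewrite ?subKr//.
  by apply: sP; rewrite /= subKr.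
Qed.

Fact hmulA : associative hmul.
Proof.
move=> f g h; apply: hahn_ext => a /=.
have [s us sP] := finite_enum (well_ordered_finite a (hahnP f)
  (well_orderedD (hahnP g) (hahnP h))).
have [r ur rP] := finite_enum (well_ordered_finite a
  (well_orderedD (hahnP f) (hahnP g)) (hahnP h)).
rewrite (@hconv_seq _ _ a s)//; last first.
  move=> c fc /= /hconv_neq0[d [gd hd]]; apply: sP; split => //.
  by exists d => //; exists (a - c - d) => //; rewrite addrC subrK.
rewrite (@hconv_seq _ _ a r)//; last first.
  move=> b /= /hconv_neq0[c [fc gc]] hb; apply: rP; split => //.
  by exists c => //; exists (b - c) => //; rewrite addrC subrK.
transitivity (\sum_(c <- s) \sum_(b <- r) f c * g (b - c) * h (a - b)).
  apply: eq_bigr => c _ /=.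
  have [->|fc] := eqVneq (f c) 0.
    by rewrite mul0r big1// => b _; rewrite !mul0r.
  rewrite (@hconv_seq _ _ (a - c) (map (fun b => b - c) r)).
  - rewrite big_map big_distrr; apply: eq_bigr => b _ /=.
    by rewrite mulrA opprB addrA subrK.
  - by rewrite map_inj_uniq// => x y /addIr.
  - move=> d gd hd; apply/mapP; exists (d + c); rewrite ?addrK//.
    apply: rP; split; first by exists c => //; exists d => //; rewrite addrC.
    by rewrite opprD addrA addrAC.
rewrite exchange_big; apply: eq_bigr => b _ /=.
have [->|hb] := eqVneq (h (a - b)) 0.
  by rewrite mulr0 big1// => c _; rewrite mulr0.
rewrite -big_distrl; congr (_ * _).
rewrite (@hconv_seq _ _ b s)// => c fc gc; apply: sP; split => //.
by exists (b - c) => //; exists (a - b) => //; rewrite addrC addrA subrK.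
Qed.

Lemma hconv_mono x c g a : hconv (hmono x c) g a = x * g (a - c).
Proof.
rewrite (@hconv_seq _ _ a [:: c])// ?big_seq1 /= ?eqxx// => b.
by rewrite inE /=; case: (b =P c) => //; rewrite eqxx.
Qed.

Fact hmul1 : left_id (hmono 1 0) hmul.
Proof. by move=> f; apply: hahn_ext => a /=; rewrite hconv_mono mul1r subr0. Qed.

Fact hmulDl : left_distributive hmul +%R.
Proof.
move=> f g h; apply: hahn_ext => a.
rewrite hcoefD /=.
have [s us sP] := finite_enum (well_ordered_finite a
  (well_orderedU (hahnP f) (hahnP g)) (hahnP h)).
have fP b : f b != 0 -> h (a - b) != 0 -> b \in s.
  by move=> fb hb; apply: sP; split=> //; left.
have gP b : g b != 0 -> h (a - b) != 0 -> b \in s.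
  by move=> gb hb; apply: sP; split=> //; right.
rewrite (hconv_seq us fP) (hconv_seq us gP) (hconv_seq us).
  by rewrite -big_split; apply: eq_bigr => b _ /=; rewrite  -mulrDl.
move=> b /=; have [->|/fP //] := eqVneq (f b) 0.
by rewrite add0r; exact: gP.
Qed.

Fact hone_neq0 : hmono 1 0 != 0.
Proof.
apply/eqP => /(congr1 (fun f : hahn R => f 0)).
by rewrite hcoef0 /= eqxx => /eqP; rewrite oner_eq0.
Qed.

HB.instance Definition _ := GRing.Zmodule_isComNzRing.Build (hahn R)
  hmulA hmulC hmul1 hmulDl hone_neq0.

Lemma hcoefM f g a : (f * g) a = \sum_(b \in [set: R]) f b * g (a - b).
Proof. by []. Qed.

Lemma hcoef1 a : (1 : hahn R) a = (a == 0)%:R.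
Proof. by rewrite /= ; case: eqP. Qed.

(* The coefficients of f g at a only depend on those of f and g on small
   exponents. *)
Lemma hcoefM_eq (f g g' : hahn R) a : (forall b, f b != 0 -> 0 <= b) ->
  (forall b, b <= a -> g b = g' b) -> (f * g) a = (f * g') a.
Proof.
move=> f0 gg'; rewrite !hcoefM; apply: eq_fsbigr => b _.
have [->|/f0 b0] := eqVneq (f b) 0; first by rewrite !mul0r.
by rewrite gg'// lerBlDr lerDl.
Qed.

Lemma hcoefX_eq0 f d n a : (forall b, f b != 0 -> d <= b) ->
  a < n%:R * d -> (f ^+ n) a = 0.
Proof.
move=> fd; elim: n a => [|n IH] a.
  by rewrite mul0r expr0 hcoef1 => /lt_eqF ->.
move=> an; apply/eqP; rewrite exprS; apply: contraT.
move=> /hconv_neq0[b [/fd db]]; rewrite IH ?eqxx//.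
move: an; rewrite -natr1 mulrDl mul1r => an.
by rewrite ltrBlDr (lt_le_trans an) ?lerD2l.
Qed.

Section Geometric.
Context (f : hahn R) (d : R).
Hypotheses (d0 : 0 < d) (fd : forall b, f b != 0 -> d <= b).

Let N a := (Num.truncn (a / d)).+1.

Let NP a : a < (N a)%:R * d.
Proof. by rewrite -ltr_pdivrMr// truncnS_gt. Qed.

Let geo n := \sum_(i < n) f ^+ i.

Let geoE n m a : a < n%:R * d -> (n <= m)%N -> geo m a = geo n a.
Proof.
move=> an nm; rewrite /geo !hcoef_sum.
rewrite (big_ord_widen m (fun i => (f ^+ i) a) nm) [RHS]big_mkcond /=.
apply: eq_bigr => i _; case: ltnP => // ni.
rewrite (hcoefX_eq0 fd)//; apply: lt_le_trans an _.
by apply: ler_wpM2r; [exact: ltW|rewrite ler_nat].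
Qed.

Let ginv_coef a := geo (N a) a.

Let ginv_le x a : a <= x -> ginv_coef a = geo (N x) a.
Proof.
move=> ax; rewrite /ginv_coef (@geoE (N a))//.
by rewrite ltnS; apply: le_truncn; rewrite ler_wpM2r// invr_ge0 ltW.
Qed.

Let ginv_subproof : well_ordered [set a | ginv_coef a != 0].
Proof.
move=> X Xg [x Xx].
have [|| m [Xm mx] mmin] := hahnP (geo (N x)) (X `&` [set a | a <= x]) _ _.
- by move=> a [Xa ax] /=; rewrite -ginv_le//; exact: Xg.
- by exists x; split => //=.
exists m => // y Xy; have [yx|/ltW xy] := leP y x; first exact: mmin.
exact: le_trans xy.
Qed.

Lemma geometric_inv : exists g, (1 - f) * g = 1.
Proof.
exists (Hahn ginv_subproof); apply: hahn_ext => a.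
rewrite (@hcoefM_eq _ _ (geo (N a))).
- rewrite /geo mulrC -opprB mulrN [_ * _]mulrC -subrX1 opprB hcoefB.
  by rewrite (hcoefX_eq0 fd)// subr0.
- move=> b; rewrite hcoefB hcoef1; have [->//|b0] := eqVneq b 0.
  by rewrite sub0r oppr_eq0 => /fd; apply: le_trans; exact: ltW.
- by move=> b; exact: ginv_le.
Qed.
End Geometric.

Lemma hahn_unit f : f != 0 -> exists g, g * f = 1.
Proof.
move=> f0.
have [s fs smin] : exists2 s, f s != 0 & forall b, f b != 0 -> s <= b.
  apply: (hahnP f) => //; apply: contrapT => nf; case/eqP: f0.
  apply: hahn_ext => a; rewrite hcoef0; apply/eqP; apply: contrapT => fa.
  by apply: nf; exists a; exact/negP.
pose u := hmono (f s)^-1 (- s) * f.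
have uE a : u a = (f s)^-1 * f (a + s) by rewrite /u /= hconv_mono opprK.
pose y := 1 - u.
have ygt0 b : y b != 0 -> 0 < b.
  rewrite hcoefB hcoef1 uE; have [->|b0] := eqVneq b 0.
    by rewrite add0r mulVf// subrr eqxx.
  rewrite sub0r oppr_eq0 mulf_eq0 negb_or => /andP[_ /smin].
  by rewrite lerDr le_eqVlt eq_sym (negPf b0).
have [d d0 yd] : exists2 d, 0 < d & forall b, y b != 0 -> d <= b.
  have [->|y0] := eqVneq y 0.
    by exists 1 => // b; rewrite hcoef0 eqxx.
  have [//||d yd dmin] := hahnP y [set a | y a != 0].
    apply: contrapT => nf; case/eqP: y0.
    apply: hahn_ext => a; rewrite hcoef0; apply/eqP; apply: contrapT => fa.
    by apply: nf; exists a; exact/negP.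
  by exists d => //; exact: ygt0.
have [g] := geometric_inv d0 yd; rewrite /y subKr => ug1.
by exists (g * hmono (f s)^-1 (- s)); rewrite -mulrA mulrC.
Qed.

Definition hinv f : hahn R :=
  if f == 0 then 0 else xget 0 [set g | g * f = 1].

Fact hmulVf f : f != 0 -> hinv f * f = 1.
Proof.
move=> f0; rewrite /hinv (negPf f0).
exact: (xgetPex 0 (hahn_unit f0)).
Qed.

Fact hinv0 : hinv 0 = 0.
Proof. by rewrite /hinv eqxx. Qed.

HB.instance Definition _ := GRing.ComNzRing_isField.Build (hahn R) hmulVf hinv0.

End Hahn.


(* The lowest exponent of f, and +oo for f = 0. *)
Definition hord (R : realType) (f : hahn R) : \bar R :=
  ereal_inf [set a%:E | a in [set a | f a != 0]].

(* The max-plus semiring R \cup {-oo}. In ring_scope its structure reads: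
   x + y is max(x, y), x * y is the sum x + y of extended reals, 0 is -oo and
   1 is the real number 0. Hence A *m B, A ^+ k, a *: A, \sum and \prod have
   their tropical meaning. *)
Record maxplus (R : realType) := MaxPlus {
  mpval :> \bar R;
  mpvalP : mpval != +oo%E }.
Arguments MaxPlus {R}.

HB.instance Definition _ (R : realType) := [isSub for @mpval R].
HB.instance Definition _ (R : realType) := [Choice of maxplus R by <:].

Section MaxPlusSemiring.
Context {R : realType}.
Implicit Types x y z : maxplus R.

Fact mpadd_subproof x y : maxe (mpval x) (mpval y) != +oo%E.
Proof. by rewrite /maxe; case: ifP => _; exact: mpvalP. Qed.

Fact mpmul_subproof x y : (mpval x + mpval y)%E != +oo%E.
Proof. by case: x y => [[x||] xP] [[y||] yP]. Qed.

Definition mpzero : maxplus R := @MaxPlus R -oo%E isT.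
Definition mpfin (r : R) : maxplus R := @MaxPlus R r%:E isT.
Definition mpadd x y := MaxPlus _ (mpadd_subproof x y).
Definition mpmul x y := MaxPlus _ (mpmul_subproof x y).

Fact mpaddA : associative mpadd.
Proof. by move=> x y z; apply: val_inj; rewrite /= maxA. Qed.
Fact mpaddC : commutative mpadd.
Proof. by move=> x y; apply: val_inj; rewrite /= maxC. Qed.
Fact mpadd0 : left_id mpzero mpadd.
Proof. by move=> x; apply: val_inj; rewrite /= maxNye. Qed.

HB.instance Definition _ :=
  GRing.isNmodule.Build (maxplus R) mpaddA mpaddC mpadd0.

Fact mpmulA : associative mpmul.
Proof. by move=> x y z; apply: val_inj; rewrite /= addeA. Qed.
Fact mpmulC : commutative mpmul.
Proof. by move=> x y; apply: val_inj; rewrite /= addeC. Qed.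
Fact mpmul1 : left_id (mpfin 0) mpmul.
Proof. by move=> x; apply: val_inj; rewrite /= add0e. Qed.
Fact mpmulDl : left_distributive mpmul +%R.
Proof.
move=> x y z; apply: val_inj.
case: x y z => [[x||] xP] [[y||] yP] [[z||] zP] //=;
  rewrite -?EFin_max -?EFinD ?addeNy ?maxxx ?maxNye ?maxeNy -?EFinD//.
by rewrite addr_maxl EFin_max.
Qed.
Fact mpmul0 : left_zero 0 mpmul.
Proof. by move=> x; apply: val_inj. Qed.
Fact mpone_neq0 : mpfin 0 != 0.
Proof. by []. Qed.

HB.instance Definition _ := GRing.Nmodule_isComNzSemiRing.Build (maxplus R)
  mpmulA mpmulC mpmul1 mpmulDl mpmul0 mpone_neq0.

HB.instance Definition _ :=
  Topological.copy (maxplus R) (initial_topology (@mpval R)).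

End MaxPlusSemiring.

Section Projective.
Context {R : realType} {n : nat}.
Implicit Types A B : 'M[maxplus R]_n.

Definition proj_eq A B : bool := `[< exists l : R, B = mpfin l *: A >].

Lemma mpfin_scaleK (l : R) m p (A : 'M[maxplus R]_(m, p)) :
  mpfin (- l) *: (mpfin l *: A) = A.
Proof.
rewrite scalerA (_ : _ * _ = 1) ?scale1r//.
by apply: val_inj; rewrite /= addeC subee.
Qed.

Fact proj_eq_equiv : equiv_class_of proj_eq.
Proof.
split.
- move=> A; apply/asboolP; exists 0; exact: (esym (scale1r A)).
- move=> A B; apply/asboolP/asboolP => -[l ->]; exists (- l);
    by rewrite mpfin_scaleK.
- move=> B A C /asboolP[l ->] /asboolP[k ->]; apply/asboolP; exists (k + l).
  by rewrite scalerA; congr (_ *: _); apply: val_inj.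
Qed.

Canonical proj_eq_rel := EquivRelPack proj_eq_equiv.

End Projective.

Definition projmx (R : realType) (n : nat) :=
  {eq_quot @proj_eq_rel R n}%qT.

HB.instance Definition _ (R : realType) n := EqQuotient.on (projmx R n).
HB.instance Definition _ (R : realType) n := Choice.on (projmx R n).

Definition proj_class (R : realType) (n : nat) (A : 'M[maxplus R]_n) :
  projmx R n :=
  (\pi_(projmx R n) A)%qT.

(* The classes of the non-null matrices carry the quotient topology and the
   class of the null matrix is an isolated point. *)
Section ProjTopology.
Context {R : realType} {n : nat}.

Lemma neq0_open : open [set x : maxplus R | x != 0].
Proof.
exists [set y | y != -oo%E]; last by [].
rewrite openE => -[r||] //= _.
  by exists 1 => /=.
by exists 0; split => // -[].
Qed.

Lemma nonnull_open : open [set A : 'M[maxplus R]_n | A != 0].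
Proof.
rewrite openE => A A0; exists (fun i j => [set x | A i j != 0 -> x != 0]).
  move=> i j; have [Aij0|Aij0] := eqVneq (A i j) 0.
    exact: filterS filterT.
  rewrite (_ : mkset _ = [set x | x != 0]); last first.
    by apply/seteqP; split=> x /= => [|x0 _]; [exact|exact: x0].
  exact: open_nbhs_nbhs (conj neq0_open Aij0).
move=> B BP; apply: contraNN A0 => /eqP B0; apply/eqP/matrixP => i j.
apply/eqP; rewrite mxE; apply: contraT => /BP; by rewrite B0 mxE eqxx.
Qed.

Definition proj_open (U : set (projmx R n)) :=
  open [set A : 'M[maxplus R]_n | A != 0 /\ U (proj_class A)].

Fact proj_openT : proj_open setT.
Proof.
rewrite /proj_open (_ : mkset _ = [set A | A != 0]); first exact: nonnull_open.
by apply/seteqP; split=> [A []//|A A0]; split.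
Qed.

Fact proj_openI : setI_closed proj_open.
Proof.
move=> U V oU oV; rewrite /proj_open; have := openI oU oV; congr open.
by apply/seteqP; split=> A /= => [[[? ?] [? ?]]|[? [? ?]]].
Qed.

Fact proj_open_bigU (I : Type) (f : I -> set (projmx R n)) :
  (forall i, proj_open (f i)) -> proj_open (\bigcup_i f i).
Proof.
move=> of_; rewrite /proj_open.
have := bigcup_open (fun i (_ : setT i) => of_ i).
congr open; apply/seteqP; split=> A /= => [[i _ [A0 fiA]]|[A0 [i _ fiA]]].
  by split=> //; exists i.
by exists i.
Qed.

HB.instance Definition _ := isOpenTopological.Build (projmx R n)
  proj_openT proj_openI proj_open_bigU.

End ProjTopology.

Definition proj_semigroup (R : realType) (n : nat) (A : 'M[maxplus R]_n) :
  set (projmx R n) := [set proj_class (A ^+ k) | k in [set k | (0 < k)%N]].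

Definition is_min (S : set nat) (u : nat) : Prop :=
  S u /\ forall v, S v -> (u <= v)%N.

(* 0 is a dummy value: every set to which nat_min, nat_gcd and the xget of
   weak_dim below are applied has exactly one eligible value. *)
Definition nat_min (S : set nat) : nat := xget 0%N (is_min S).

Definition nat_gcd (S : set nat) : nat := xget 0%N [set d |
  (forall l, S l -> (d %| l)%N) /\
  (forall e, (forall l, S l -> (e %| l)%N) -> (e %| d)%N)].

(* No special case is needed for null matrices: all these ranks give 0. *)
Section Ranks.
Context {R : realType}.
Local Notation T := (maxplus R).

Definition perm_weight r (B : 'M[T]_r) (s : 'S_r) : T := \prod_i B i (s i).

Definition per r (B : 'M[T]_r) : T := \sum_(s : 'S_r) perm_weight B s.

(* In \prod_i and \sum_s, read sum and max. The null 1 x 1 matrix attains its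
   permanent only once, hence the separate clause. *)
Definition singular r (B : 'M[T]_r) : bool :=
  (r == 1%N) && (B == 0) ||
  [exists s : 'S_r, exists s' : 'S_r,
    [&& s != s', perm_weight B s == per B & perm_weight B s' == per B]].

Definition det_plus r (B : 'M[T]_r) : T :=
  \sum_(s : 'S_r | ~~ odd_perm s) perm_weight B s.

Definition det_minus r (B : 'M[T]_r) : T :=
  \sum_(s : 'S_r | odd_perm s) perm_weight B s.

Definition increasing r m (f : {ffun 'I_r -> 'I_m}) : bool :=
  [forall i : 'I_r, forall j : 'I_r, (i < j)%N ==> (f i < f j)%N].

Definition max_submatrix (P : forall r, 'M[T]_r -> bool) m n
    (A : 'M[T]_(m, n)) : nat :=
  \max_(r < (minn m n).+1 |
      [exists f : {ffun 'I_r -> 'I_m}, exists g : {ffun 'I_r -> 'I_n},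
        [&& increasing f, increasing g & P r (mxsub f g A)]]) r.

Definition tropical_rank m n (A : 'M[T]_(m, n)) : nat :=
  max_submatrix (fun r B => ~~ singular B) A.

Definition symmetrized_rank m n (A : 'M[T]_(m, n)) : nat :=
  max_submatrix (fun r B => det_plus B != det_minus B) A.

Definition gm_independent m n (A : 'M[T]_(m, n)) (S : {set 'I_m}) : Prop :=
  forall (I J : {set 'I_m}) (a : 'I_m -> T),
    I \subset S -> J \subset S -> [disjoint I & J]%B ->
    (exists2 i, (i \in I) || (i \in J) & a i != 0) ->
    \sum_(i in I) a i *: row i A <> \sum_(j in J) a j *: row j A.

Definition gm_row_rank m n (A : 'M[T]_(m, n)) : nat :=
  \max_(S : {set 'I_m} | `[< gm_independent A S >]) #|S|.

Definition gm_column_rank m n (A : 'M[T]_(m, n)) : nat := gm_row_rank A^T.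

Definition kapranov_rank m n (A : 'M[T]_(m, n)) : nat :=
  nat_min [set \rank F | F in [set F : 'M[hahn R]_(m, n) |
    forall i j, (- hord (F i j))%E = A i j]].

Definition schein_rank m n (A : 'M[T]_(m, n)) : nat :=
  nat_min [set r | exists (B : 'M[T]_(m, r)) (C : 'M[T]_(r, n)), A = B *m C].

Definition tconv n (G : {fset 'rV[T]_n}) : set 'rV[T]_n :=
  [set v | exists a : 'rV[T]_n -> T, v = \sum_(s <- G) a s *: s].

Definition weak_dim n (C : set 'rV[T]_n) : nat := xget 0%N [set d |
  exists G : {fset 'rV[T]_n}, [/\ #|` G| = d, tconv G = C &
    forall H : {fset 'rV[T]_n}, (H `<` G)%fset -> tconv H <> C]].

Definition row_rank m n (A : 'M[T]_(m, n)) : nat :=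
  weak_dim (tconv [fset row i A | i in 'I_m]%fset).

Definition column_rank m n (A : 'M[T]_(m, n)) : nat := row_rank A^T.

End Ranks.

Inductive rank_notion :=
  | Tropical | Symmetrized | GMRow | GMColumn
  | Kapranov | Schein | Row | Column.

Definition rk (R : realType) (star : rank_notion) (m n : nat)
    (A : 'M[maxplus R]_(m, n)) : nat :=
  match star with
  | Tropical => tropical_rank A
  | Symmetrized => symmetrized_rank A
  | GMRow => gm_row_rank A
  | GMColumn => gm_column_rank A
  | Kapranov => kapranov_rank A
  | Schein => schein_rank A
  | Row => row_rank A
  | Column => column_rank A
  end.

Section Graph.
Context {R : realType} {n : nat}.
Implicit Types (A : 'M[maxplus R]_n) (e : rel 'I_n) (c : seq 'I_n).

Definition arc_rel A : rel 'I_n := fun i j => A i j != 0.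

(* A closed walk is given by the sequence of its successive nodes. *)
Definition circuit e c : bool := (c != [::]) && path.cycle e c.

Definition circuit_arcs c : seq ('I_n * 'I_n) := zip c (rot 1 c).

Definition mean_weight A c : \bar R :=
  ((\sum_(p <- circuit_arcs c) (A p.1 p.2 : \bar R)) *
   ((size c)%:R^-1 : R)%:E)%E.

Definition rho A : \bar R :=
  \big[maxe/-oo%E]_(1 <= j < n.+1) \big[maxe/-oo%E]_(c : j.-tuple 'I_n)
    mean_weight A c.

Definition critical A c : bool :=
  circuit (arc_rel A) c && (mean_weight A c == rho A).

Definition crit_arc A : rel 'I_n := fun i j =>
  `[< exists2 c, critical A c & (i, j) \in circuit_arcs c >].

Definition crit_node A : {set 'I_n} :=
  finset (fun i => `[< exists2 c, critical A c & i \in c >]).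

Definition crit_components A : {set {set 'I_n}} :=
  equivalence_partition
    (fun i j => connect (crit_arc A) i j && connect (crit_arc A) j i)
    (crit_node A).

(* The cyclicity of the subgraph of e induced by C. *)
Definition cyclicity e (C : {set 'I_n}) : nat :=
  nat_gcd [set size c | c in [set c | circuit e c && all (mem C) c]].

End Graph.

(* Main.v *)
Require Import Defs.
From HB Require Import structures.
From mathcomp Require Import all_boot all_order all_algebra all_fingroup.
From mathcomp Require Import finmap.
From mathcomp Require Import all_classical all_reals topology ereal.
From mathcomp Require Import normedtype complex ring lra zify.

(** Let E be the critical graph of A and u the sum of the cyclicities of its
    components. The theorem says that every limit of projective powers of A has
    all its ranks at least u, and that one limit has all its ranks equal to u.

    If A has no circuit then A ^+ n is null, with all ranks 0, and E is empty.
    Otherwise the maximal circuit mean lam of A is finite, and a diagonal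
    similarity followed by a scaling turns A into a matrix W whose entries are 1
    (the real number 0) on the arcs of E and at most - eps < 0 elsewhere
    ([strict_visualisation]). From then on only the combinatorics of E matters:
    an entry of W ^+ t is 1 if E has a walk of length t between the two
    vertices, and at most - eps otherwise ([vis_pow]).

    Fix L such that each critical vertex has a closed critical walk of length L,
    and identify two critical vertices joined by a critical walk of length
    divisible by L. A component of cyclicity d splits into d classes, so there
    are u classes ([card_reps]); let X contain one vertex of each.

    Lower bound. For each t, let Y x be the end of a critical walk of length t
    from x in X. In W ^+ t the submatrix of rows X and columns Y has diagonal 1
    and entries at most - eps off the diagonal, for otherwise two elements of X
    would be equivalent. These conditions compare pairs of entries with a
    uniform eps, so they are closed and scale invariant and pass to all nonnull
    limits ([dominated_rk], [rk_closure_ge]). Such a dominant submatrix is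
    non-singular with an optimal permutation certified by potentials, which
    bounds all the ranks from below ([rk_ge_dominant]).

    Upper bound. The powers W ^+ (L * k) converge to the matrix P such that P i j
    is the maximum over x in X of P i x + P x j, since long walks either use the
    critical graph or lose eps at each step ([pow_le_projector],
    [projector_reps]). Thus the rows and the columns of P are generated by u of
    them, and all the ranks of P are at most u ([rk_le_factor]).

    Comparing the ranks uses two tools. A tropical factorisation lifts to a
    factorisation over generalized power series with positive leading
    coefficients; as such coefficients do not cancel, linear algebra over the
    series yields that the symmetrized, Gondran-Minoux and Kapranov ranks are at
    most the Schein rank. For the row rank, an irredundant generating set is
    contained, up to scaling, in every generating set
    ([irredundant_scaled_mem]), which identifies the weak dimension. *)

Set Implicit Arguments.
Unset Strict Implicit.
Unset Printing Implicit Defensive.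

Import Order.TTheory GRing.Theory Num.Theory.

Local Open Scope classical_set_scope.
Local Open Scope ring_scope.

(** * Order of the max-plus semiring *)

Section MaxPlusOrder.
Context {R : realType}.
Local Notation T := (maxplus R).
Implicit Types (x y z : T).

Definition mple x y := ((x : \bar R) <= y)%E.
Definition mplt x y := ((x : \bar R) < y)%E.
Local Notation "x <=+ y" := (mple x y) (at level 70).
Local Notation "x <+ y" := (mplt x y) (at level 70).

Variant maxplus_spec x : Type :=
  | MaxPlusNull of x = 0 : maxplus_spec x
  | MaxPlusFin r of x = mpfin r : maxplus_spec x.

Lemma maxplusP x : maxplus_spec x.
Proof.
case: x => [[r||] xP] //; first by apply: (@MaxPlusFin _ r); apply: val_inj.
by apply: MaxPlusNull; apply: val_inj.
Qed.

Lemma mplexx x : x <=+ x. Proof. exact: lexx. Qed.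
Lemma mple_trans y x z : x <=+ y -> y <=+ z -> x <=+ z.
Proof. exact: le_trans. Qed.
Lemma mple_anti x y : x <=+ y -> y <=+ x -> x = y.
Proof. by move=> xy yx; apply: val_inj; apply/le_anti/andP. Qed.
Lemma mple0 x : 0 <=+ x. Proof. exact: leNye. Qed.
Lemma mplt0 x : (0 <+ x) = (x != 0).
Proof. by rewrite /mplt ltNye. Qed.
Lemma mple_fin (a b : R) : (mpfin a <=+ mpfin b) = (a <= b).
Proof. exact: lee_fin. Qed.
Lemma mplt_fin (a b : R) : (mpfin a <+ mpfin b) = (a < b).
Proof. exact: lte_fin. Qed.
Lemma mpltNge x y : (x <+ y) = ~~ (y <=+ x). Proof. exact: ltNge. Qed.
Lemma mpleNgt x y : (x <=+ y) = ~~ (y <+ x). Proof. exact: leNgt. Qed.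
Lemma mpltW x y : x <+ y -> x <=+ y. Proof. exact: ltW. Qed.
Lemma mplt_le_trans y x z : x <+ y -> y <=+ z -> x <+ z.
Proof. exact: lt_le_trans. Qed.
Lemma mple_lt_trans y x z : x <=+ y -> y <+ z -> x <+ z.
Proof. exact: le_lt_trans. Qed.
Lemma mpltxx x : (x <+ x) = false. Proof. exact: ltxx. Qed.
Lemma mplt_neqAle x y : (x <+ y) = (x != y) && (x <=+ y).
Proof. exact: lt_neqAle. Qed.

Lemma mpfin_neq0 (a : R) : mpfin a != 0. Proof. by []. Qed.
Lemma mpfinD (a b : R) : mpfin (a + b) = mpfin a * mpfin b.
Proof. exact: val_inj. Qed.
Lemma mpfin0 : mpfin 0 = 1 :> T. Proof. by []. Qed.
Lemma mpfin_inj : injective (@mpfin R).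
Proof. by move=> a b /(congr1 val) /= []. Qed.

Lemma mpfin_prod I (r : seq I) (P : pred I) (f : I -> R) :
  \prod_(i <- r | P i) mpfin (f i) = mpfin (\sum_(i <- r | P i) f i).
Proof. by rewrite (big_morph mpfin mpfinD mpfin0). Qed.

Lemma mpfinX (a : R) k : mpfin a ^+ k = mpfin (a *+ k).
Proof. by elim: k => [|k IH]; rewrite ?expr0 ?mulr0n// exprS IH mulrS mpfinD. Qed.

Lemma mpmul_eq0 x y : (x * y == 0) = (x == 0) || (y == 0).
Proof.
case: (maxplusP x) => [->|a ->]; first by rewrite mul0r !eqxx.
case: (maxplusP y) => [->|b ->]; first by rewrite mulr0 !eqxx orbT.
by rewrite -mpfinD.
Qed.

Lemma mpleM x y x' y' : x <=+ x' -> y <=+ y' -> x * y <=+ x' * y'.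
Proof. exact: leeD. Qed.

Lemma mpltM x y x' y' : x <+ x' -> y <=+ y' -> y' != 0 -> x * y <+ x' * y'.
Proof.
case: (maxplusP y') => [->|b ->]; first by rewrite eqxx.
move=> xx' yb _; apply: mple_lt_trans (mpleM (mplexx x) yb) _.
case: (maxplusP x') xx' => [->|a -> xa].
  by rewrite mpltNge mple0.
case: (maxplusP x) xa => [->|c ->].
  by rewrite mul0r !mplt0 => _; rewrite -mpfinD mpfin_neq0.
by rewrite -!mpfinD !mplt_fin ltrD2r.
Qed.

Lemma mpltMr x y x' y' : x <=+ x' -> y <+ y' -> x' != 0 -> x * y <+ x' * y'.
Proof. by move=> xx' yy' x0; rewrite (mulrC x) (mulrC x'); apply: mpltM. Qed.

Lemma mple_mulfin (a : R) x y : (mpfin a * x <=+ mpfin a * y) = (x <=+ y).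
Proof.
apply/idP/idP => [/(mpleM (mplexx (mpfin (- a))))|]; last exact/mpleM/mplexx.
by rewrite !mulrA -mpfinD addNr !mul1r.
Qed.

Lemma mple_add x y z : (x + y <=+ z) = (x <=+ z) && (y <=+ z).
Proof. by rewrite /mple /= ge_max. Qed.

Lemma mple_addl x y : x <=+ x + y.
Proof. by rewrite /mple /= le_max lexx. Qed.

Lemma mple_addr x y : y <=+ x + y.
Proof. by rewrite /mple /= le_max lexx orbT. Qed.

Lemma mple_addE x y : (x <=+ y) = (x + y == y).
Proof.
apply/idP/eqP => [xy|<-]; last exact: mple_addl.
by apply: mple_anti (mple_addr _ _); rewrite mple_add xy mplexx.
Qed.

Lemma mpaddxx x : x + x = x.
Proof. by apply/eqP; rewrite -mple_addE mplexx. Qed.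

Lemma mpadd_eq x y : x + y = x \/ x + y = y.
Proof.
have [xy|/ltW yx] := leP (x : \bar R) y.
  by right; apply/eqP; rewrite -mple_addE.
by left; apply/eqP; rewrite addrC -mple_addE.
Qed.

Lemma mpsum_le I (r : seq I) (P : pred I) (F : I -> T) y :
  (forall i, P i -> F i <=+ y) -> \sum_(i <- r | P i) F i <=+ y.
Proof.
move=> Fy; elim/big_rec: _ => [|i z Pi zy]; first exact: mple0.
by rewrite mple_add Fy.
Qed.

Lemma mple_sum (I : finType) (P : pred I) (F : I -> T) j :
  P j -> F j <=+ \sum_(i | P i) F i.
Proof. by move=> Pj; rewrite (bigD1 j)//= mple_addl. Qed.

Lemma mple_sum_seq (I : eqType) (r : seq I) (F : I -> T) j :
  j \in r -> F j <=+ \sum_(i <- r) F i.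
Proof.
elim: r => // i r IH; rewrite inE big_cons => /predU1P[->|/IH jr].
  exact: mple_addl.
exact: mple_trans jr (mple_addr _ _).
Qed.

Lemma mpsum_eq I (r : seq I) (P : pred I) (F : I -> T) :
  \sum_(i <- r | P i) F i = 0 \/
  exists2 i, P i & \sum_(i <- r | P i) F i = F i.
Proof.
elim/big_ind: _ => [|x y hx hy|i Pi]; [by left| |by right; exists i].
by case: (mpadd_eq x y) => ->.
Qed.

Lemma mpsum_attained I (r : seq I) (P : pred I) (F : I -> T) :
  \sum_(i <- r | P i) F i != 0 ->
  exists2 i, P i & \sum_(i <- r | P i) F i = F i.
Proof. by case: (mpsum_eq r P F) => [->|//]; rewrite eqxx. Qed.

Lemma mpleS I (r : seq I) (P : pred I) (F G : I -> T) :
  (forall i, P i -> F i <=+ G i) ->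
  \sum_(i <- r | P i) F i <=+ \sum_(i <- r | P i) G i.
Proof.
move=> FG; elim/big_rec2: _ => [|i x y Pi xy]; first exact: mplexx.
rewrite mple_add (mple_trans (FG i Pi) (mple_addl _ _)).
exact: mple_trans xy (mple_addr _ _).
Qed.

Lemma mpprod_lt (I : finType) (F G : I -> T) j :
  (forall i, F i <=+ G i) -> (forall i, G i != 0) -> F j <+ G j ->
  \prod_i F i <+ \prod_i G i.
Proof.
move=> FG G0 Fj; rewrite (bigD1 j)//= [X in _ <+ X](bigD1 j)//=.
apply: mpltM => //.
  by elim/big_rec2: _ => [|i x y _ xy]; [exact: mplexx|exact: mpleM].
elim/big_rec: _ => [|i y _ y0]; first exact: mpfin_neq0.
by rewrite mpmul_eq0 negb_or G0.
Qed.

Lemma mpsum_lt I (r : seq I) (P : pred I) (F : I -> T) y : 0 <+ y ->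
  (forall i, P i -> F i <+ y) -> \sum_(i <- r | P i) F i <+ y.
Proof.
move=> y0 Fy; elim/big_rec: _ => // i z Pi zy.
by case: (mpadd_eq (F i) z) => ->; rewrite // Fy.
Qed.

End MaxPlusOrder.

Notation "x <=+ y" := (mple x y) (at level 70).
Notation "x <+ y" := (mplt x y) (at level 70).
Arguments mple_trans {R} y {x z} _ _.
Arguments mple_lt_trans {R} y {x z} _ _.
Arguments mplt_le_trans {R} y {x z} _ _.
#[global] Hint Resolve mplexx mple0 : core.

(** * Walk lengths modulo a period and cyclicity *)

Lemma nat_gcdP (S : set nat) d : (forall l, S l -> (d %| l)%N) ->
  (forall f, (forall l, S l -> (f %| l)%N) -> (f %| d)%N) -> nat_gcd S = d.
Proof.
move=> dS dmax; apply: xget_unique => // d' [d'S d'max].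
by apply/eqP; rewrite eqn_dvd d'max//= dmax.
Qed.

Section Walks.
Context {n : nat} (e : rel 'I_n).
Implicit Types (i j k : 'I_n) (s t m : nat).

Fixpoint walk t i j : bool :=
  if t is t'.+1 then [exists k, e i k && walk t' k j] else i == j.

Lemma walk_add s t i j k : walk s i j -> walk t j k -> walk (s + t) i k.
Proof.
elim: s i => [|s IH] i /=; first by move=> /eqP->.
move=> /existsP[l /andP[il lj]] jk; apply/existsP; exists l.
by rewrite il IH.
Qed.

Lemma walk1 i j : walk 1 i j = e i j.
Proof.
by apply/existsP/idP => [[k /andP[ik /eqP<-]]|ij] //; exists j; rewrite ij eqxx.
Qed.

Lemma walk_mul s t i : walk t i i -> walk (s * t) i i.
Proof.
move=> ti; elim: s => [|s IH]; first by rewrite mul0n /=.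
by rewrite mulSn; apply: walk_add ti IH.
Qed.

Lemma walkP t i j :
  reflect (exists p, [/\ path e i p, size p = t & last i p = j]) (walk t i j).
Proof.
apply: (iffP idP).
  elim: t i => [|t IH] i /=; first by move=> /eqP->; exists [::].
  move=> /existsP[k /andP[ik /IH[p [kp <- <-]]]].
  by exists (k :: p); rewrite /= ik.
move=> [p [+ <- <-]]; elim: p i => [|k p IH] i /=; first by rewrite eqxx.
by move=> /andP[ik /IH kp]; apply/existsP; exists k; rewrite ik.
Qed.

Lemma walk_connect t i j : walk t i j -> connect e i j.
Proof. by move=> /walkP[p [ip _ <-]]; apply/connectP; exists p. Qed.

Lemma connect_walk i j : connect e i j -> exists t, walk t i j.
Proof.
by move=> /connectP[p ip ->]; exists (size p); apply/walkP; exists p.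
Qed.

Lemma circuit_walk c i : circuit e c -> i \in c -> walk (size c) i i.
Proof.
move=> /andP[_ ec] ic; have [k p rE] := rot_to ic.
have : path.cycle e (i :: p) by rewrite -rE rot_cycle.
rewrite /= => ip; apply/walkP; exists (rcons p i).
by rewrite ip last_rcons size_rcons -(size_rot k c) rE.
Qed.

Lemma walk_circuit t i : walk t.+1 i i -> exists c,
  [/\ circuit e c, size c = t.+1, i \in c &
      forall j, j \in c -> connect e i j && connect e j i].
Proof.
move=> /walkP[p [ip sp li]]; case/lastP: p => [//|p j] in ip sp li *.
rewrite last_rcons in li; rewrite li in ip sp *.
exists (i :: p); split; rewrite ?mem_head//.
- by rewrite /= -sp size_rcons.
- by move=> k kc; rewrite !(connect_cycle (p := i :: p))// ?mem_head.
Qed.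

Hypothesis back : forall i j, e i j -> connect e j i.

Lemma connect_return i j : connect e i j -> connect e j i.
Proof.
move=> /connectP[p ip ->]; elim: p i ip => [|k p IH] i //= /andP[ik /IH kp].
exact: connect_trans kp (back ik).
Qed.

Lemma walk_return t i j : walk t i j -> exists s, walk s j i.
Proof. by move=> /walk_connect/connect_return/connect_walk. Qed.

(** As every arc lies on a circuit, the vertices with an outgoing arc are exactly the
    vertices of the circuits. *)
Definition node i : bool := [exists j, e i j].

Lemma node_walk t i j : node i -> walk t i j -> node j.
Proof.
elim: t i => [|t IH] i Ni /=; first by move=> /eqP<-.
move=> /existsP[k /andP[ik]]; apply: IH.
have /walk_return[[|s]] : walk 1 i k by rewrite walk1.
  by move=> /= /eqP->.
by move=> /= /existsP[l /andP[kl _]]; apply/existsP; exists l.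
Qed.

Lemma node_circuit i : node i -> exists2 t, (0 < t)%N & walk t i i.
Proof.
move=> /existsP[j ij]; rewrite -walk1 in ij.
by have [s ji] := walk_return ij; exists (1 + s)%N => //; apply: walk_add ij ji.
Qed.

Lemma node_walk_all t i : node i -> exists j, walk t i j.
Proof.
elim: t i => [|t IH] i Ni; first by exists i => /=.
have /existsP[k ik] := Ni.
have [|j kj] := IH k; first by apply: (node_walk (t := 1) Ni); rewrite walk1.
by exists j; apply/existsP; exists k; rewrite ik.
Qed.

(** The product of the lengths of closed walks chosen at the vertices. *)
Lemma common_period : exists2 L, (0 < L)%N & forall i, node i -> walk L i i.
Proof.
have /fin_all_exists[l lP] i : exists t, (0 < t)%N && (node i ==> walk t i i).
  have [Ni|nNi] := boolP (node i); last by exists 1%N.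
  by have [t t0 ti] := node_circuit Ni; exists t; rewrite t0 ti.
exists (\prod_i l i)%N; first by rewrite prodn_gt0// => i; case/andP: (lP i).
move=> i Ni; rewrite (bigD1 i)//= mulnC; apply: walk_mul.
by case/andP: (lP i) => _ /implyP; apply.
Qed.

Section Residues.
Context (L : nat) (L0 : (0 < L)%N) (Lwalk : forall i, node i -> walk L i i).

Definition mwalk m i j := exists2 t, t = m %[mod L] & walk t i j.

Lemma mwalk_eq m m' i j : m = m' %[mod L] -> mwalk m i j -> mwalk m' i j.
Proof. by move=> mm' [t tm ij]; exists t; rewrite ?tm. Qed.

Lemma mwalk_trans m m' i j k :
  mwalk m i j -> mwalk m' j k -> mwalk (m + m') i k.
Proof.
move=> [t tm ij] [t' tm' jk]; exists (t + t')%N; last exact: walk_add ij jk.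
by rewrite -modnDm tm tm' modnDm.
Qed.

Lemma mwalk_mul s m i : mwalk m i i -> mwalk (s * m) i i.
Proof.
move=> [t tm ii]; exists (s * t)%N; last exact: walk_mul.
by rewrite -modnMmr tm modnMmr.
Qed.

(** Close the walk into a circuit and run around it: L times the circuit, less the
    walk itself, has length opposite to that of the walk modulo L. Residues of walk
    lengths thus behave as in a group. *)
Lemma mwalk_return m i j : mwalk m i j -> mwalk (L.-1 * m) j i.
Proof.
move=> [t tm ij]; have [s ji] := walk_return ij.
exists (L.-1 * (s + t) + s)%N; last first.
  exact: walk_add (walk_mul _ (walk_add ji ij)) ji.
rewrite (_ : (_ + _)%N = L.-1 * t + s * L)%N; last first.
  by rewrite mulnDr -[in (s * L)%N](prednK L0) mulnS mulnC; lia.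
by rewrite addnC modnMDl -modnMmr tm modnMmr.
Qed.

Lemma mwalk0_refl i : mwalk 0 i i.
Proof. by exists 0%N => /=. Qed.

Lemma mwalk0_sym i j : mwalk 0 i j -> mwalk 0 j i.
Proof. by move=> /mwalk_return; rewrite muln0. Qed.

Lemma mwalk0_trans j i k : mwalk 0 i j -> mwalk 0 j k -> mwalk 0 i k.
Proof. exact: mwalk_trans. Qed.

Lemma mwalk_node m i j : node i -> mwalk m i j -> node j.
Proof. by move=> Ni [t _]; apply: node_walk. Qed.

(** The residues of closed walks at r form a subgroup of the integers modulo L;
    d is its least positive element. *)
Lemma residue_period r : node r -> exists d,
  [/\ (0 < d)%N, mwalk d r r, (d %| L)%N & forall m, mwalk m r r -> (d %| m)%N].
Proof.
move=> Nr.
have rL : mwalk L r r by exists L => //; exact: Lwalk.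
pose P d := `[< (0 < d)%N /\ mwalk d r r >].
have Pex : exists d, P d by exists L; apply/asboolP.
case: (ex_minnP Pex) => d /asboolP[d0 dr] dmin.
have key m : mwalk m r r -> (d %| m)%N.
  move=> mr; rewrite /dvdn; apply/negP => /negP; rewrite -lt0n => md0.
  suff /dmin : P (m %% d)%N by rewrite leqNgt ltn_mod d0.
  apply/asboolP; split => //.
  have qr := mwalk_mul (m %/ d) dr.
  apply: mwalk_eq (mwalk_trans mr (mwalk_return qr)).
  rewrite {1}(divn_eq m d).
  rewrite (_ : (_ + _)%N = m %/ d * d * L + m %% d)%N ?modnMDl//.
  by rewrite -[in RHS](prednK L0); lia.
by exists d; split => //; apply: key.
Qed.

(** A circuit of the component of r can be inserted in a closed walk at r, so its
    length is a difference of two closed walk lengths at r. Conversely a common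
    divisor of the circuit lengths divides L and every closed walk length at r. *)
Lemma cyclicity_least_residue r d (C : {set 'I_n}) : node r -> (0 < d)%N ->
  mwalk d r r -> (forall m, mwalk m r r -> (d %| m)%N) ->
  (forall j, (j \in C) = connect e r j && connect e j r) ->
  cyclicity e C = d.
Proof.
move=> Nr d0 dr dmin CE; apply: nat_gcdP.
  move=> _ [c /andP[ec /allP cC] <-].
  have [i ic] : exists i, i \in c.
    by move: ec => /andP[]; case: (c) => // i ? _; exists i; rewrite mem_head.
  have ii := circuit_walk ec ic.
  have := cC _ ic; rewrite inE CE => /andP[/connect_walk[a ri] /connect_walk[b ir]].
  have dab : (d %| a + b)%N.
    by apply: dmin; exists (a + b)%N => //; apply: walk_add ri ir.
  rewrite -(dvdn_addl _ dab); apply: dmin; exists (size c + (a + b))%N => //.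
  by rewrite addnCA; apply: walk_add ri (walk_add ii ir).
move=> f fP.
have key t : (0 < t)%N -> walk t r r -> (f %| t)%N.
  case: t => // t _ /walk_circuit[c [ec <- _ cr]]; apply: fP; exists c => //.
  by rewrite /= ec; apply/allP => j /cr; rewrite inE CE.
have fL : (f %| L)%N by apply: key => //; exact: Lwalk.
(* adding L makes the length positive *)
have [t td rr] := dr; have /key : walk (t + L) r r.
  by apply: walk_add rr (Lwalk Nr).
rewrite addn_gt0 L0 orbT => /(_ isT); rewrite dvdn_addl//.
by rewrite /dvdn -(modn_dvdm t fL) td modn_dvdm.
Qed.

Definition cong i j := `[< mwalk 0 i j >].

Lemma congP i j : reflect (mwalk 0 i j) (cong i j).
Proof. exact: asboolP. Qed.

Lemma cong_eq i j : cong i j -> cong i =1 cong j.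
Proof.
move=> /congP ij k; apply/congP/congP; apply: mwalk0_trans => //.
exact: mwalk0_sym.
Qed.

(** A choice of representative that depends only on the class of i modulo [cong]. *)
Definition rep i := odflt i [pick j | cong i j].

Lemma cong_rep i : cong i (rep i).
Proof.
rewrite /rep; case: pickP => [//|/(_ i)/congP []]; exact: mwalk0_refl.
Qed.

Lemma rep_eq i j : (rep i == rep j) = cong i j.
Proof.
apply/eqP/idP => [ij|ij].
  apply/congP; apply: mwalk0_trans (congP _ _ (cong_rep i)) _.
  by rewrite ij; apply/mwalk0_sym/congP/cong_rep.
rewrite /rep (eq_pick (cong_eq ij)); case: pickP => [//|/(_ j)/congP []].
exact: mwalk0_refl.
Qed.

Definition reps := rep @: finset node.

Lemma rep_node i : node i -> node (rep i).
Proof. by move=> Ni; apply: mwalk_node Ni (congP _ _ (cong_rep i)). Qed.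

Lemma reps_node x : x \in reps -> node x.
Proof. by rewrite /reps => /imsetP[j]; rewrite inE => /rep_node Nj ->. Qed.

Lemma reps_sep x y : x \in reps -> y \in reps -> mwalk 0 x y -> x = y.
Proof.
rewrite /reps => /imsetP[i _ ->] /imsetP[j _ ->] xy; apply/eqP; rewrite rep_eq.
apply/congP; apply: mwalk0_trans (congP _ _ (cong_rep i)) _.
apply: mwalk0_trans xy _; apply: mwalk0_sym; exact/congP/cong_rep.
Qed.

Lemma reps_cover i : node i -> exists2 x, x \in reps & mwalk 0 i x.
Proof.
move=> Ni; exists (rep i); last exact/congP/cong_rep.
by apply: imset_f; rewrite inE.
Qed.

Lemma mwalk_connect m i j : mwalk m i j -> connect e i j.
Proof. by move=> [t _]; apply: walk_connect. Qed.

(** From r, walks of lengths 0, ..., d - 1 end in pairwise different classes, where d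
    is the cyclicity, and every vertex of the component is in one of these classes. *)
Lemma card_reps_component r (C : {set 'I_n}) : node r ->
  (forall j, (j \in C) = connect e r j && connect e j r) ->
  #|reps :&: C| = cyclicity e C.
Proof.
move=> Nr CE; have [d [d0 dr dL dmin]] := residue_period Nr.
rewrite (cyclicity_least_residue Nr d0 dr dmin CE).
have [z zP] := fin_all_exists (fun i : 'I_d => node_walk_all i Nr).
have zm (i : 'I_d) : mwalk i r (z i) by exists i.
rewrite -[RHS]card_ord (_ : _ :&: _ = (rep \o z) @: 'I_d); last first.
  apply/setP => x; rewrite inE; apply/andP/imsetP => [[/imsetP[v]]|[i _ ->]].
    rewrite inE => Nv ->; rewrite CE => /andP[rx _].
    have [t rv] : exists t, walk t r v.
      apply: connect_walk; apply: connect_trans rx _.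
      exact/mwalk_connect/mwalk0_sym/congP/cong_rep.
    have tv : mwalk t r v by exists t.
    exists (Ordinal (ltn_pmod t d0)) => //=; apply/eqP; rewrite rep_eq.
    apply/congP; set i := Ordinal _.
    have qr := mwalk_mul (t %/ d) dr.
    (* the length is - t + (t - t %% d) + t %% d modulo L *)
    apply: mwalk_eq (mwalk_trans (mwalk_trans (mwalk_return tv) qr) (zm i)).
    rewrite -addnA -divn_eq -mulSnr prednK// mod0n.
    by rewrite -modnMml modnn mul0n mod0n.
  have Nz : node (z i) := mwalk_node Nr (zm i).
  split; first by apply: imset_f; rewrite inE.
  have rz : connect e r (rep (z i)).
    apply: connect_trans (mwalk_connect (zm i)) _.
    exact/mwalk_connect/congP/cong_rep.
  by rewrite CE rz; apply: connect_return.
apply: card_imset => i j /= /eqP; rewrite rep_eq => /congP zij; apply/val_inj/eqP.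
have := dmin _ (mwalk_trans (mwalk_trans (zm i) zij) (mwalk_return (zm j))).
rewrite addn0 => dij; have /eqP: (i + L.-1 * j + j = j %[mod d])%N.
  by rewrite -modnDml (eqP dij) add0n.
rewrite -addnA -mulSnr prednK// addnC.
have /dvdnP[q ->] := dL.
rewrite mulnAC modnMDl !modn_small//.
Qed.

Lemma card_reps : #|reps| = (\sum_(C in
  equivalence_partition (fun i j => connect e i j && connect e j i)
    (finset node)) cyclicity e C)%N.
Proof.
set N := finset node; set P := equivalence_partition _ _.
have partP : finset.partition P N.
  apply: finset.equivalence_partitionP => i j k _ _ _; split; first by rewrite connect0.
  move=> /andP[ij ji]; apply/andP/andP => -[xk kx].
    by split; [exact: connect_trans ji xk|exact: connect_trans kx ij].
  by split; [exact: connect_trans ij xk|exact: connect_trans kx ji].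
transitivity (\sum_(i in N) (i \in reps))%N.
  rewrite -sum1_card [RHS]big_mkcond [LHS]big_mkcond; apply: eq_bigr => i _.
  case: (boolP (i \in reps)) => [/reps_node Ni|_]; last by rewrite if_same.
  by rewrite inE Ni.
rewrite (set_partition_big _ partP); apply: eq_bigr => C /imsetP[r].
rewrite inE => Nr CE.
rewrite -(card_reps_component (r := r))//; last first.
  move=> j; rewrite CE !inE; case: (boolP (connect e r j)) => [rj|]/=.
    by have [t /(node_walk Nr)->] := connect_walk rj.
  by rewrite andbF.
rewrite -sum1_card [LHS]big_mkcond [RHS]big_mkcond; apply: eq_bigr => i _.
by rewrite inE; case: (i \in reps); case: (i \in C).
Qed.

End Residues.
End Walks.

(** * Leading terms of generalized power series *)

Section Lift.
Context {R : realType}.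
Local Notation T := (maxplus R).
Implicit Types (x y : T) (f g : hahn R) (Q : R[i] -> Prop).

(** f = 0 when x is null, and otherwise - ord f = x and the leading coefficient of f
    satisfies Q. The condition Q is a parameter because three of them occur:
    nonzero, positive, and [lexpos]. When Q excludes 0 and is stable under addition,
    leading terms never cancel, and - ord turns sums into tropical sums. *)
Definition leads Q x f :=
  (forall b, x <+ mpfin (- b) -> f b = 0) /\
  (forall r, x = mpfin r -> Q (f (- r))).

Lemma leads0 Q : leads Q 0 0.
Proof. by split=> [b _|r /eqP]; [exact: hcoef0|rewrite eq_sym]. Qed.

Lemma leads_imply Q Q' x f : (forall z, Q z -> Q' z) -> leads Q x f -> leads Q' x f.
Proof. by move=> QQ' [lo hi]; split=> // r xr; apply/QQ'/hi. Qed.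

Lemma leadsDr Q x y f g : x <+ y -> leads Q y g ->
  (forall b, x <+ mpfin (- b) -> f b = 0) -> leads Q y (f + g).
Proof.
move=> xy [glo ghi] flo; split=> [b yb|r yr]; rewrite hcoefD.
  by rewrite glo// flo ?addr0//; apply: mplt_le_trans xy (mpltW yb).
by rewrite flo ?add0r ?opprK -?yr//; apply: ghi.
Qed.

Lemma leadsD Q x y f g : (forall z t, Q z -> Q t -> Q (z + t)) ->
  leads Q x f -> leads Q y g -> leads Q (x + y) (f + g).
Proof.
move=> QD fx gy; have [xy|xy|xy] := ltgtP (x : \bar R) y.
- by rewrite (eqP (_ : x + y == y)) -?mple_addE ?mpltW//; apply: leadsDr fx.1.
- rewrite [x + y]addrC [f + g]addrC.
  by rewrite (eqP (_ : y + x == x)) -?mple_addE ?mpltW//; apply: leadsDr gy.1.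
- have {xy}xy : x = y by apply: val_inj.
  rewrite -{}xy mpaddxx in gy *; have [[flo fhi] [glo ghi]] := (fx, gy).
  split=> [b xb|r xr]; rewrite hcoefD; first by rewrite flo// glo// addr0.
  by apply: QD; [exact: fhi|exact: ghi].
Qed.

Lemma leads_sum Q I (r : seq I) (P : pred I) (F : I -> T) (f : I -> hahn R) :
  (forall z t, Q z -> Q t -> Q (z + t)) ->
  (forall i, P i -> leads Q (F i) (f i)) ->
  leads Q (\sum_(i <- r | P i) F i) (\sum_(i <- r | P i) f i).
Proof.
move=> QD Ff; elim/big_rec2: _ => [|i x y Pi xy]; first exact: leads0.
by apply: leadsD => //; apply: Ff.
Qed.

Lemma leadsM Q1 Q2 Q x y f g : (forall z t, Q1 z -> Q2 t -> Q (z * t)) ->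
  leads Q1 x f -> leads Q2 y g -> leads Q (x * y) (f * g).
Proof.
move=> QM [flo fhi] [glo ghi].
case: (maxplusP x) flo fhi => [->|r ->] flo fhi.
  have -> : f = 0 by apply: hahn_ext => b; rewrite flo ?hcoef0 ?mplt0.
  by rewrite !mul0r; exact: leads0.
case: (maxplusP y) glo ghi => [->|s ->] glo ghi.
  have -> : g = 0 by apply: hahn_ext => b; rewrite glo ?hcoef0 ?mplt0.
  by rewrite !mulr0; exact: leads0.
have supp b a : f b != 0 -> g (a - b) != 0 -> - r <= b /\ b <= a + s.
  move=> fb gb; split.
    rewrite leNgt; apply: contra_neqN fb => br; apply: flo.
    by rewrite mplt_fin ltrNr.
  rewrite leNgt; apply: contra_neqN gb => br; apply: glo.
  by rewrite mplt_fin; lra.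
rewrite -mpfinD; split=> [b|t /mpfin_inj <-].
  rewrite mplt_fin => rsb; apply/eqP; apply: contraT.
  by move=> /hconv_neq0[c [fc gc]]; have := supp _ _ fc gc; lra.
rewrite [X in Q X](@hconv_seq _ f g _ [:: - r])//; last first.
  by move=> b fb gb; have := supp _ _ fb gb; rewrite inE => ?; apply/eqP; lra.
rewrite big_seq1 (_ : - (r + s) - - r = - s); last by lra.
by apply: QM; [exact: fhi|exact: ghi].
Qed.

Lemma leads_mono r : leads (fun z => 0 < z) (mpfin r) (hmono 1 (- r)).
Proof.
split=> [b|s /mpfin_inj <-] /=; last by rewrite eqxx.
by rewrite mplt_fin; case: eqP => // ->; rewrite opprK ltxx.
Qed.

Lemma leads_one : leads (fun z => 0 < z) 1 1.
Proof. by have := leads_mono 0; rewrite oppr0. Qed.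

Lemma leads_prod Q I (r : seq I) (F : I -> T) (f : I -> hahn R) :
  Q 1 -> (forall z t, Q z -> Q t -> Q (z * t)) ->
  (forall i, leads Q (F i) (f i)) ->
  leads Q (\prod_(i <- r) F i) (\prod_(i <- r) f i).
Proof.
move=> Q1 QM Ff; elim/big_rec2: _ => [|i x y _ xy]; last exact: (leadsM QM (Ff i) xy).
by split=> [b|s]; [have := leads_one.1 b|]; rewrite // hcoef1 => /mpfin_inj <-;
  rewrite oppr0 eqxx.
Qed.

Lemma hahn_lead f : f != 0 ->
  exists2 s, f s != 0 & forall b, f b != 0 -> s <= b.
Proof.
move=> f0; apply: (hahnP f) => //; apply: contrapT => nf; case/eqP: f0.
apply: hahn_ext => a; rewrite hcoef0; apply/eqP; apply: contrapT => fa.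
by apply: nf; exists a; exact/negP.
Qed.

Lemma hord_min f s : f s != 0 -> (forall b, f b != 0 -> s <= b) ->
  hord f = s%:E.
Proof.
move=> fs smin; apply/le_anti/andP; split.
  by apply: ereal_inf_lbound; exists s.
by apply: le_ereal_inf_tmp => _ [b fb <-]; rewrite lee_fin smin.
Qed.

Lemma hord0 : hord (0 : hahn R) = +oo%E.
Proof.
rewrite /hord (_ : [set _ | _ in _] = set0) ?ereal_inf0//.
by apply/seteqP; split=> // x [a + _]; rewrite /mkset hcoef0 eqxx.
Qed.

Lemma leads_ord x f : leads (fun z => z != 0) x f <-> (- hord f)%E = x.
Proof.
have [->|f0] := eqVneq f 0.
  rewrite hord0; split=> [[_ hi]|x0].
    case: (maxplusP x) hi => [->//|r -> /(_ _ erefl)].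
    by rewrite hcoef0 eqxx.
  by rewrite (_ : x = 0); [exact: leads0|apply: val_inj; rewrite /= -x0].
have [s fs smin] := hahn_lead f0; rewrite (hord_min fs smin).
split=> [[lo hi]|xs].
  case: (maxplusP x) lo hi => [-> lo|r -> lo /(_ _ erefl) hi].
    by case/eqP: fs; apply: lo; rewrite mplt0.
  rewrite /=; congr EFin; have := smin _ hi.
  suff : - r <= s by lra.
  rewrite leNgt; apply: contra_neqN fs => br; apply: lo.
  by rewrite mplt_fin; lra.
have {xs}-> : x = mpfin (- s) by apply: val_inj; rewrite /= -xs.
split=> [b|r /mpfin_inj <-]; last by rewrite opprK.
rewrite mplt_fin ltrN2 => bs; apply/eqP; apply: contraT => /smin.
by rewrite leNgt bs.
Qed.

Lemma leads_uniq Q x y f : (forall z, Q z -> z != 0) ->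
  leads Q x f -> leads Q y f -> x = y.
Proof.
move=> Q0 /(leads_imply Q0)/leads_ord xE /(leads_imply Q0)/leads_ord yE.
by apply: val_inj; rewrite /= -xE -yE.
Qed.

(** Half of the nonzero complex numbers: a cone stable under addition and under
    multiplication by positive reals, which meets each pair z, - z exactly once.
    It plays the role of a sign for complex coefficients. *)
Definition lexpos (z : R[i]) : bool :=
  (0 < complex.Re z) || (complex.Re z == 0) && (0 < complex.Im z).

Lemma lexposD z t : lexpos z -> lexpos t -> lexpos (z + t).
Proof.
case: z t => [a b] [c d]; rewrite /lexpos /= => /orP[a0|/andP[/eqP-> b0]].
  by move=> /orP[c0|/andP[/eqP-> d0]]; apply/orP; left; lra.
move=> /orP[c0|/andP[/eqP-> d0]]; apply/orP; first by left; lra.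
by right; rewrite addr0 eqxx /= addr_gt0.
Qed.

Lemma lexpos_neq0 z : lexpos z -> z != 0.
Proof.
by apply: contraTneq => ->; rewrite /lexpos /= ltxx eqxx.
Qed.

Lemma lexpos_or_opp z : z != 0 -> lexpos z || lexpos (- z).
Proof.
case: z => [a b]; rewrite /lexpos eq_complex /= => nz.
rewrite oppr_eq0 !oppr_gt0; move: nz.
by case: (ltgtP a 0); case: (ltgtP b 0).
Qed.

Lemma lexposM z t : 0 < t -> lexpos z -> lexpos (t * z).
Proof.
case: z t => [a b] [c d]; rewrite ltcE /= => /andP[/eqP -> c0].
rewrite /lexpos /= !mul0r subr0 addr0 => /orP[a0|/andP[/eqP-> b0]].
  by rewrite mulr_gt0.
by rewrite mulr0 eqxx mulr_gt0// orbT.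
Qed.

Lemma leads_null Q f : leads Q 0 f -> f = 0.
Proof. by move=> [lo _]; apply: hahn_ext => b; rewrite lo ?hcoef0 ?mplt0. Qed.

Lemma hahn_sign f : exists x, leads lexpos x f \/ leads lexpos x (- f).
Proof.
have [->|f0] := eqVneq f 0; first by exists 0; left; exact: leads0.
have [s fs smin] := hahn_lead f0; exists (mpfin (- s)).
have lo b : mpfin (- s) <+ mpfin (- b) -> f b = 0.
  rewrite mplt_fin ltrN2 => bs; apply/eqP; apply: contraT => /smin.
  by rewrite leNgt bs.
have /orP[pf|pf] := lexpos_or_opp fs; [left|right]; split.
- exact: lo.
- by move=> r /mpfin_inj <-; rewrite opprK.
- by move=> b /lo fb; rewrite hcoefN fb oppr0.
- by move=> r /mpfin_inj <-; rewrite opprK.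
Qed.

End Lift.

(** * Ranks bounded above by the Schein rank *)

Lemma nat_minP (S : set nat) : S !=set0 -> is_min S (nat_min S).
Proof.
move=> [k Sk]; apply: (@xgetPex _ 0%N (is_min S)).
pose P k := `[< S k >]; have Pex : exists k, P k by exists k; apply/asboolP.
case: (ex_minnP Pex) => m /asboolP Sm mmin; exists m; split=> // v Sv.
by apply: mmin; apply/asboolP.
Qed.

Section RankBasics.
Context {R : realType}.
Local Notation T := (maxplus R).

Lemma max_submatrix_le (P : forall r, 'M[T]_r -> bool) m n (A : 'M[T]_(m, n)) k :
  (forall r (f : 'I_r -> 'I_m) (g : 'I_r -> 'I_n), P r (mxsub f g A) -> (r <= k)%N) ->
  (max_submatrix P A <= k)%N.
Proof.
move=> rk; apply/bigmax_leqP => r /existsP[f /existsP[g /and3P[_ _]]]; exact: rk.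
Qed.

Lemma increasing_inj r m (f : {ffun 'I_r -> 'I_m}) : increasing f -> injective f.
Proof.
move=> /forallP finc i j fij; apply: val_inj.
have lt (i' j' : 'I_r) : (i' < j')%N -> (f i' < f j')%N.
  by have /forallP/(_ j')/implyP := finc i'.
by have [/lt|/lt|//] := ltngtP i j; rewrite fij ltnn.
Qed.

Lemma max_submatrix_ge (P : forall r, 'M[T]_r -> bool) m n (A : 'M[T]_(m, n)) r
    (f : {ffun 'I_r -> 'I_m}) (g : {ffun 'I_r -> 'I_n}) :
  increasing f -> increasing g -> P r (mxsub f g A) ->
  (r <= max_submatrix P A)%N.
Proof.
move=> finc ginc PA; have rmn : (r < (minn m n).+1)%N.
  rewrite ltnS leq_min; apply/andP; split.
    by have := leq_card _ (increasing_inj finc); rewrite !card_ord.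
  by have := leq_card _ (increasing_inj ginc); rewrite !card_ord.
have := @leq_bigmax_cond _ (fun r : 'I_(minn m n).+1 =>
      [exists f : {ffun 'I_r -> 'I_m}, exists g : {ffun 'I_r -> 'I_n},
        [&& increasing f, increasing g & P r (mxsub f g A)]])
      (fun r => r : nat) (Ordinal rmn).
apply; apply/existsP; exists f; apply/existsP; exists g; exact/and3P.
Qed.

Lemma schein_witness m n (A : 'M[T]_(m, n)) :
  exists (B : 'M[T]_(m, schein_rank A)) (C : 'M[T]_(schein_rank A, n)), A = B *m C.
Proof.
have [|//] := @nat_minP [set r | exists (B : 'M[T]_(m, r)) (C : 'M[T]_(r, n)), A = B *m C].
by exists n, A, 1%:M; rewrite mulmx1.
Qed.

Lemma schein_le m n r (B : 'M[T]_(m, r)) (C : 'M[T]_(r, n)) :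
  (schein_rank (B *m C) <= r)%N.
Proof.
have [|_ min] := @nat_minP [set r' |
    exists (B' : 'M[T]_(m, r')) (C' : 'M[T]_(r', n)), B *m C = B' *m C'].
  by exists r, B, C.
by apply: min; exists B, C.
Qed.

Lemma schein_tr m n (A : 'M[T]_(m, n)) : (schein_rank A^T <= schein_rank A)%N.
Proof.
have [B [C {1}->]] := schein_witness A; rewrite trmx_mul; exact: schein_le.
Qed.

Definition hlift (x : T) : hahn R :=
  if mpval x is r%:E%E then hmono 1 (- r) else 0.

Lemma leads_hlift x : leads (fun z => 0 < z) x (hlift x).
Proof. by case: (maxplusP x) => [|r] ->; [exact: leads0|exact: leads_mono]. Qed.

Definition pos_lift m n (A : 'M[T]_(m, n)) (F : 'M[hahn R]_(m, n)) :=
  forall i j, leads (fun z => 0 < z) (A i j) (F i j).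

(** Lift the two factors of A entrywise to monomials. Their product has positive
    leading coefficients, so no cancellation occurs and it lifts A. *)
Lemma schein_lift m n (A : 'M[T]_(m, n)) :
  exists2 F, pos_lift A F & (\rank F <= schein_rank A)%N.
Proof.
have [B [C {1}->]] := schein_witness A.
exists (map_mx hlift B *m map_mx hlift C); last exact: mulmx_max_rank.
move=> i j; rewrite !mxE; apply: leads_sum => [z t|k _]; first exact: addr_gt0.
rewrite !mxE; apply: leadsM (leads_hlift _) (leads_hlift _) => z t.
exact: mulr_gt0.
Qed.

Lemma kapranov_le_lift m n (A : 'M[T]_(m, n)) (F : 'M[hahn R]_(m, n)) :
  (forall i j, (- hord (F i j))%E = A i j) -> (kapranov_rank A <= \rank F)%N.
Proof.
move=> FA; have [|_ min] := @nat_minP [set \rank F | F in [set F : 'M[hahn R]_(m, n) |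
    forall i j, (- hord (F i j))%E = A i j]]; first by exists (\rank F), F.
by apply: min; exists F.
Qed.

Lemma kapranov_witness m n (A : 'M[T]_(m, n)) : exists F : 'M[hahn R]_(m, n),
  (forall i j, (- hord (F i j))%E = A i j) /\ \rank F = kapranov_rank A.
Proof.
have [|[F FA FE] _] := @nat_minP [set \rank F | F in [set F : 'M[hahn R]_(m, n) |
    forall i j, (- hord (F i j))%E = A i j]]; last by exists F.
exists (\rank (map_mx hlift A)), (map_mx hlift A) => //= i j.
rewrite mxE; apply/leads_ord; apply: leads_imply (leads_hlift _) => z.
by rewrite lt0r => /andP[].
Qed.

Lemma kapranov_le_schein m n (A : 'M[T]_(m, n)) :
  (kapranov_rank A <= schein_rank A)%N.
Proof.
have [F AF Frk] := schein_lift A; apply: leq_trans Frk.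
apply: kapranov_le_lift => i j; apply/leads_ord; apply: leads_imply (AF i j) => z.
by rewrite lt0r => /andP[].
Qed.

Lemma det_rank_lt r m n (F : 'M[hahn R]_(m, n)) (f : 'I_r -> 'I_m) (g : 'I_r -> 'I_n) :
  (\rank F < r)%N -> \det (mxsub f g F) = 0.
Proof.
move=> rF; apply/eqP; apply: contraTT rF => dF; rewrite -leqNgt.
have : row_free (mxsub f g F) by rewrite row_free_unit unitmxE unitfE.
rewrite /row_free => /eqP {1}<-.
rewrite -[F in mxsub f g F]mul1mx mxsub_mul.
apply: leq_trans (mxrankM_maxr _ _) _.
by rewrite -[F in colsub g F]mulmx1 -mulmx_colsub mxrankM_maxl.
Qed.

(** A minor of size larger than the rank of the lift vanishes, hence its even and odd parts are equal
    series. These parts are sums of products of positive elements, so the equality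
    passes to their orders, which are the two tropical half-determinants. *)
Lemma symmetrized_le_schein m n (A : 'M[T]_(m, n)) :
  (symmetrized_rank A <= schein_rank A)%N.
Proof.
have [F AF Frk] := schein_lift A; apply: max_submatrix_le => r f g.
apply: contraNT; rewrite -ltnNge => /(leq_ltn_trans Frk)/det_rank_lt.
move=> /(_ f g); rewrite /determinant (bigID (fun s : 'S_r => odd_perm s)) /=.
have lift (s : 'S_r) : leads (fun z => 0 < z) (perm_weight (mxsub f g A) s)
    (\prod_i mxsub f g F i (s i)).
  apply: leads_prod => [|z t|i]; [exact: ltr01|exact: mulr_gt0|].
  by rewrite !mxE.
have lifts (P : pred 'S_r) :
    leads (fun z => 0 < z) (\sum_(s | P s) perm_weight (mxsub f g A) s)
      (\sum_(s | P s) \prod_i mxsub f g F i (s i)).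
  by apply: leads_sum => [z t|s _]; [exact: addr_gt0|exact: lift].
under eq_bigr => s -> do rewrite expr1 mulN1r.
under [X in _ + X]eq_bigr => s /negPf-> do rewrite expr0 mul1r.
rewrite sumrN addrC => /eqP; rewrite subr_eq0 => /eqP dE.
apply/eqP; apply: (@leads_uniq _ (fun z => 0 < z) _ _
  (\sum_(s : 'S_r | ~~ odd_perm s) \prod_i mxsub f g F i (s i))).
- by move=> z; exact: lt0r_neq0.
- exact: lifts.
- by rewrite dE; exact: lifts.
Qed.

(** More rows than the rank of the lift F are linearly dependent over the field of
    series. Moving the terms whose coefficient is negative for [lexpos] to the other
    side gives an equality between two sums without cancellation, which becomes a
    Gondran-Minoux dependence after taking orders. *)
Lemma gm_row_le_schein m n (A : 'M[T]_(m, n)) : (gm_row_rank A <= schein_rank A)%N.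
Proof.
have [F AF Frk] := schein_lift A; apply/bigmax_leqP => S /asboolP indS.
apply: leq_trans Frk; rewrite leqNgt; apply/negP => rS.
pose f (k : 'I_#|S|) : 'I_m := enum_val k.
have [u uF u0] : exists2 u : 'rV[hahn R]_#|S|, u *m rowsub f F = 0 & u != 0.
  have : kermx (rowsub f F) != 0.
    rewrite kermx_eq0 /row_free neq_ltn; apply/orP; left.
    apply: leq_ltn_trans rS; rewrite rowsubE; exact: mxrankM_maxr.
  move=> /rowV0Pn[u /sub_kermxP uF u0]; by exists u.
(* the dependence, extended by 0 outside S *)
pose c : 'rV_m := u *m rowsub f 1%:M.
have cF : c *m F = 0 by rewrite /c -mulmxA -rowsubE.
have cS i : c 0 i != 0 -> i \in S.
  apply: contraR => iS; rewrite mxE big1// => k _; rewrite !mxE.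
  case: eqP => [fk|_]; last by rewrite mulr0.
  by case/negP: iS; rewrite -fk; exact: enum_valP.
have [i0 ci0] : exists i, c 0 i != 0.
  have /rV0Pn[k uk] := u0; exists (f k).
  rewrite mxE (bigD1 k)//= !mxE eqxx mulr1 big1 ?addr0// => l lk.
  by rewrite !mxE (inj_eq enum_val_inj) (negPf lk) mulr0.
clearbody c; have /fin_all_exists[a aP] i := hahn_sign (c 0 i).
pose pos i := `[< leads lexpos (a i) (c 0 i) >].
pose I := finset (fun i => (c 0 i != 0) && pos i).
pose J := finset (fun i => (c 0 i != 0) && ~~ pos i).
have a0 i : c 0 i != 0 -> a i != 0.
  apply: contra_neq => ai; case: (aP i); rewrite ai => /leads_null//.
  by move=> /eqP; rewrite oppr_eq0 => /eqP.
apply: (indS I J a).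
- by apply/fintype.subsetP => i; rewrite inE => /andP[/cS].
- by apply/fintype.subsetP => i; rewrite inE => /andP[/cS].
- by apply/pred0P => i /=; rewrite !inE; case: (pos i); rewrite !(andbT, andbF).
- by exists i0; [rewrite !inE ci0; case: (pos i0)|exact: a0].
apply/rowP => j; rewrite !summxE.
have lexposM' (z t : R[i]) : lexpos z -> 0 < t -> lexpos (z * t).
  by move=> z0 t0; rewrite mulrC lexposM.
have EI : leads lexpos (\sum_(i in I) (a i *: row i A) 0 j) (\sum_(i in I) c 0 i * F i j).
  apply: leads_sum => [|i]; first exact: lexposD.
  rewrite inE !mxE => /andP[_ /asboolP pi]; exact: (leadsM lexposM' pi (AF i j)).
have EJ : leads lexpos (\sum_(i in J) (a i *: row i A) 0 j) (\sum_(i in J) - c 0 i * F i j).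
  apply: leads_sum => [|i]; first exact: lexposD.
  rewrite inE !mxE => /andP[_ /asboolP ni]; apply: (leadsM lexposM' _ (AF i j)).
  by case: (aP i).
apply: leads_uniq EI _; first exact: lexpos_neq0.
rewrite (_ : \sum_(i in I) _ = \sum_(i in J) - c 0 i * F i j)//.
apply/eqP; rewrite -subr_eq0 -sumrN.
under [X in _ + X]eq_bigr do rewrite mulNr opprK.
apply/eqP; transitivity ((c *m F) 0 j); last by rewrite cF mxE.
rewrite mxE [RHS](bigID pos) /=; congr (_ + _).
  rewrite [LHS]big_mkcond [RHS]big_mkcond; apply: eq_bigr => i _ /=.
  by rewrite inE; case: eqVneq => [->|]; rewrite ?mul0r /= ?if_same.
rewrite [LHS]big_mkcond [RHS]big_mkcond; apply: eq_bigr => i _ /=.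
by rewrite inE; case: eqVneq => [->|]; rewrite ?mul0r /= ?if_same.
Qed.

Lemma gm_column_le_schein m n (A : 'M[T]_(m, n)) : (gm_column_rank A <= schein_rank A)%N.
Proof. exact: leq_trans (gm_row_le_schein _) (schein_tr _). Qed.

End RankBasics.

(** * Ranks bounded below by dominant submatrices *)

Section UniqueMax.
Context {R : realType}.
Local Notation T := (maxplus R).

Definition unique_max r (N : 'M[T]_r) (t0 : 'S_r) :=
  perm_weight N t0 != 0 /\
  forall t, t != t0 -> perm_weight N t <+ perm_weight N t0.

Lemma unique_max_per r (N : 'M[T]_r) t0 : unique_max N t0 -> per N = perm_weight N t0.
Proof.
move=> [N0 tmax]; apply: mple_anti; last exact: mple_sum.
apply: mpsum_le => t _; have [->//|/tmax] := eqVneq t t0; exact: mpltW.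
Qed.

Lemma nonsingularP r (N : 'M[T]_r) :
  reflect (exists t0, unique_max N t0) (~~ singular N).
Proof.
apply: (iffP idP) => [|[t0 Nt0]].
  rewrite negb_or => /andP[N1 nex].
  have uniq s s' : perm_weight N s = per N -> perm_weight N s' = per N -> s = s'.
    move=> sE s'E; apply/eqP; apply: contraNT nex => ss'.
    by apply/existsP; exists s; apply/existsP; exists s'; rewrite ss' sE s'E !eqxx.
  have [/eqP pN|pN] := boolP (per N == 0).
    have w0 s : perm_weight N s = 0.
      by apply: mple_anti (mple0 _); rewrite -pN; apply: mple_sum.
    case: r => [|[|r]] in N N1 nex uniq w0 pN *.
    - by have := w0 1%g; rewrite /perm_weight big_ord0 => /eqP.
    - case/negP: N1; apply/eqP/matrixP => i j; rewrite !ord1 mxE.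
      by have := w0 1%g; rewrite /perm_weight big_ord1 perm1.
    - have /permP/(_ ord0) := uniq (tperm ord0 ord_max) 1%g
        (etrans (w0 _) (esym pN)) (etrans (w0 _) (esym pN)).
      by rewrite tpermL perm1.
  have [t0 _ t0E] := mpsum_attained pN.
  have pt0 : perm_weight N t0 = per N by [].
  exists t0; split; first by rewrite pt0.
  move=> t tt0; rewrite mplt_neqAle pt0 mple_sum// andbT.
  by apply: contraNneq tt0 => tE; rewrite (uniq _ _ tE pt0).
have [N0 tmax] := Nt0; rewrite negb_or; apply/andP; split.
  apply/negP => /andP[/eqP r1 /eqP NE]; case/eqP: N0.
  subst r; rewrite /perm_weight big_ord1 NE mxE //.
apply/existsPn => s; apply/existsPn => s'; apply/negP => /and3P[ss' /eqP sE /eqP s'E].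
rewrite (unique_max_per Nt0) in sE s'E.
have lt s1 : perm_weight N s1 = perm_weight N t0 -> s1 = t0.
  by move=> s1E; apply/eqP; apply: contraT => /tmax; rewrite s1E mpltxx.
by move: ss'; rewrite (lt _ sE) (lt _ s'E) eqxx.
Qed.

Lemma unique_max_det r (N : 'M[T]_r) t0 : unique_max N t0 -> det_plus N != det_minus N.
Proof.
move=> [N0 tmax].
have lt (P : pred 'S_r) : ~~ P t0 -> \sum_(s | P s) perm_weight N s <+ perm_weight N t0.
  move=> Pt0; apply: mpsum_lt => [|s Ps]; first by rewrite mplt0.
  by apply: tmax; apply: contraNneq Pt0 => <-.
apply/eqP => dE; have [t0odd|t0even] := boolP (odd_perm t0).
  have l : det_plus N <+ perm_weight N t0 by apply: lt; rewrite t0odd.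
  have := mplt_le_trans _ l (mple_sum (P := fun s : 'S_r => odd_perm s) _ t0odd).
  by rewrite dE mpltxx.
have l : det_minus N <+ perm_weight N t0 by apply: lt.
have := mplt_le_trans _ l (mple_sum (P := fun s : 'S_r => ~~ odd_perm s) _ t0even).
by rewrite -[\sum_(_ | _) _]/(det_plus N) dE mpltxx.
Qed.

(** The term of the determinant attached to t0 strictly dominates all the others, so
    it cannot be cancelled. *)
Lemma unique_max_lift_det r (N : 'M[T]_r) t0 (F : 'M[hahn R]_r) :
  unique_max N t0 -> (forall i j, (- hord (F i j))%E = N i j) -> \det F != 0.
Proof.
move=> [N0 tmax] FN; pose Q (z : R[i]) := z != 0.
have lw t : leads Q (perm_weight N t) (\prod_i F i (t i)).
  apply: leads_prod => [|z s z0 s0|i]; [exact: oner_neq0|by rewrite /Q mulf_neq0|].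
  by apply/leads_ord; rewrite FN.
have ls t : leads Q (perm_weight N t) ((-1) ^+ odd_perm t * \prod_i F i (t i)).
  have [lo hi] := lw t; case: (odd_perm t); last by rewrite expr0 mul1r.
  rewrite expr1 mulN1r; split=> [b /lo fb|s /hi]; rewrite hcoefN ?fb ?oppr0//.
  by rewrite /Q oppr_eq0.
have : leads Q (perm_weight N t0) (\det F).
  rewrite /determinant (bigD1 t0)//= addrC.
  pose x := \sum_(t | t != t0) perm_weight N t.
  apply: (@leadsDr _ _ x); [|exact: ls|].
    by apply: mpsum_lt => [|t]; [rewrite mplt0|exact: tmax].
  move=> b xb; rewrite hcoef_sum big1// => t tt0; apply: (ls t).1.
  by apply: mple_lt_trans xb; apply: mple_sum.
move=> ld; apply: contra_neq N0 => d0; rewrite d0 in ld.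
by apply: (leads_uniq _ ld (leads0 _)).
Qed.

Lemma max_submatrix_sub (P P' : forall r, 'M[T]_r -> bool) m n (A : 'M[T]_(m, n)) :
  (forall r (N : 'M[T]_r), P r N -> P' r N) ->
  (max_submatrix P A <= max_submatrix P' A)%N.
Proof.
move=> PP'; apply/bigmax_leqP => r /existsP[f /existsP[g /and3P[finc ginc PA]]].
by apply: max_submatrix_ge finc ginc _; apply: PP'.
Qed.

Lemma tropical_le_symmetrized m n (A : 'M[T]_(m, n)) :
  (tropical_rank A <= symmetrized_rank A)%N.
Proof.
apply: max_submatrix_sub => r N /nonsingularP[t0]; exact: unique_max_det.
Qed.

Lemma tropical_le_kapranov m n (A : 'M[T]_(m, n)) :
  (tropical_rank A <= kapranov_rank A)%N.
Proof.
have [F [FA <-]] := kapranov_witness A.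
apply: max_submatrix_le => r f g /nonsingularP[t0 Nt0]; rewrite leqNgt.
apply/negP => /(@det_rank_lt _ r _ _ F f g)/eqP; apply/negP.
by apply: unique_max_lift_det Nt0 _ => i j; rewrite !mxE.
Qed.

End UniqueMax.

Section Dominant.
Context {R : realType}.
Local Notation T := (maxplus R).

(** The rows f and columns g of B, rescaled by - a and - b, have ones on the diagonal
    and entries below 1 elsewhere: the potentials a and b certify that the identity
    is the unique optimal permutation. *)
Definition dominant m n (B : 'M[T]_(m, n)) r (f : 'I_r -> 'I_m) (g : 'I_r -> 'I_n) :=
  exists a b : 'I_r -> R, forall i j,
    if i == j then B (f i) (g j) = mpfin (a i + b j)
    else B (f i) (g j) <+ mpfin (a i + b j).

Lemma dominant_tr m n (B : 'M[T]_(m, n)) r (f : 'I_r -> 'I_m) (g : 'I_r -> 'I_n) :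
  dominant B f g -> dominant B^T g f.
Proof.
move=> [a [b ab]]; exists b, a => i j.
by have := ab j i; rewrite mxE eq_sym [b i + _]addrC.
Qed.

Lemma dominant_inj m n (B : 'M[T]_(m, n)) r (f : 'I_r -> 'I_m) (g : 'I_r -> 'I_n) :
  dominant B f g -> injective f.
Proof.
move=> [a [b ab]] i j fij; apply/eqP; apply: contraT => ij.
have := ab i i; have := ab j j; have := ab i j; have := ab j i.
rewrite !eqxx eq_sym (negPf ij) fij => + + jj ii.
by rewrite ii jj !mplt_fin; lra.
Qed.

Lemma increasing_perm r m (f : 'I_r -> 'I_m) : injective f ->
  exists s : 'S_r, increasing [ffun i => f (s i)].
Proof.
move=> finj.
pose leT i j := (f i <= f j)%N; pose l := sort leT (enum 'I_r).
have sl : size l = r by rewrite size_sort size_enum_ord.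
have ul : uniq l by rewrite sort_uniq enum_uniq.
have fl : sorted ltn (map (fun i => f i : nat) l).
  rewrite ltn_sorted_uniq_leq map_inj_uniq ?ul => [|i j /val_inj/finj//].
  by rewrite sorted_map; apply: sort_sorted => i j; exact: leq_total.
have sinj : injective (fun i : 'I_r => nth i l i).
  move=> i j /eqP; rewrite (set_nth_default j) ?sl// nth_uniq ?sl//.
  by move=> /eqP/val_inj.
exists (perm sinj); apply/forallP => i; apply/forallP => j; apply/implyP => ij.
rewrite !ffunE !permE.
have := sorted_ltn_nth ltn_trans 0%N fl.
move=> /(_ i j); rewrite !inE size_map sl !ltn_ord => /(_ isT isT ij).
by rewrite (nth_map i) ?sl// (nth_map j) ?sl.
Qed.

(** The definition of the rank uses increasing selections of rows and columns; sorting
    f and g replaces the identity by another unique optimal permutation. *)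
Lemma dominant_tropical m n (B : 'M[T]_(m, n)) r (f : 'I_r -> 'I_m) (g : 'I_r -> 'I_n) :
  dominant B f g -> (r <= tropical_rank B)%N.
Proof.
move=> domB; have [a [b ab]] := domB.
have [s sinc] := increasing_perm (dominant_inj domB).
have [s' s'inc] := increasing_perm (dominant_inj (dominant_tr domB)).
apply: max_submatrix_ge sinc s'inc _; apply/nonsingularP.
pose t0 := (s * s'^-1)%g; exists t0.
set N := mxsub _ _ _.
pose G (t : 'S_r) i := mpfin (a (s i) + b (s' (t i))) : T.
have le (t : 'S_r) i : N i (t i) <+ G t i \/ t i = t0 i /\ N i (t i) = G t i.
  rewrite /N /G !mxE !ffunE; have := ab (s i) (s' (t i)).
  case: eqP => [E|_]; [move=> ->; right; split=> //|by left].
  by rewrite /t0 permM E permK.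
have wG (t : 'S_r) : \prod_i G t i = mpfin (\sum_i a i + \sum_i b i).
  rewrite mpfin_prod big_split /=; congr (mpfin (_ + _)).
    by rewrite [RHS](reindex_inj (@perm_inj _ s)).
  rewrite [RHS](reindex_inj (@perm_inj _ (t * s')%g)).
  by apply: eq_bigr => i _; rewrite permM.
have Nt0 : perm_weight N t0 = mpfin (\sum_i a i + \sum_i b i).
  rewrite -(wG t0); apply: eq_bigr => i _.
  rewrite /N /G !mxE !ffunE; have := ab (s i) (s' (t0 i)).
  by rewrite /t0 permM permKV eqxx.
split=> [|t tt0]; rewrite Nt0; first exact: mpfin_neq0.
have [i ti] : exists i, t i != t0 i.
  apply/existsP; apply: contraNT tt0 => /existsPn ne; apply/eqP/permP => i.
  by apply/eqP; have := ne i; rewrite negbK.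
rewrite -(wG t); apply: (@mpprod_lt _ _ _ _ i) => [k|k|].
- by case: (le t k) => [/mpltW//|[_ ->]].
- exact: mpfin_neq0.
- by case: (le t i) => [//|[/eqP]]; rewrite (negPf ti).
Qed.

(** In a dependence between rows f, let k0 be the row whose rescaled coefficient is
    the largest. In column g k0, its term exceeds strictly all the others, so the two
    sides differ there. *)
Lemma dominant_gm m n (B : 'M[T]_(m, n)) r (f : 'I_r -> 'I_m) (g : 'I_r -> 'I_n) :
  dominant B f g -> (r <= gm_row_rank B)%N.
Proof.
move=> domB; have finj := dominant_inj domB; have [a [b ab]] := domB.
have indS : gm_independent B (f @: 'I_r).
  move=> I J u IS JS IJ [i0 i0IJ ui0] E.
  pose v k := if (f k \in I) || (f k \in J) then u (f k) * mpfin (a k) else 0 : T.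
  have sumv : \sum_k v k != 0.
    apply: contra_neq ui0 => v0.
    have /imsetP[k _ i0E] : i0 \in f @: 'I_r.
      by case/orP: (i0IJ) => ?; [apply: (fintype.subsetP IS)|apply: (fintype.subsetP JS)].
    have : v k = 0 by apply: mple_anti (mple0 _); rewrite -v0; apply: mple_sum.
    rewrite /v -i0E i0IJ => /eqP; rewrite mpmul_eq0 (negPf (mpfin_neq0 _)) orbF.
    by move=> /eqP.
  have [k0 _ k0E] := mpsum_attained sumv.
  have vk0 : v k0 != 0 by rewrite -k0E.
  have k0IJ : (f k0 \in I) || (f k0 \in J).
    by apply: contraNT vk0; rewrite /v => /negPf->.
  (* in column g k0 every other term is strictly below the term of k0 *)
  have col k : (f k \in I) || (f k \in J) -> k != k0 ->
      u (f k) * B (f k) (g k0) <+ v k0 * mpfin (b k0).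
    move=> kIJ kk0; have := ab k k0; rewrite (negPf kk0) => Bk.
    have vk : u (f k) * mpfin (a k) <+ v k0 \/
        u (f k) != 0 /\ u (f k) * mpfin (a k) <=+ v k0.
      have : v k <=+ v k0 by rewrite -k0E; apply: mple_sum.
      rewrite [v k]/v kIJ => le; have [->|uk] := eqVneq (u (f k)) 0; last by right.
      by left; rewrite mul0r mplt0.
    case: vk => [lt|[uk le]].
      apply: mple_lt_trans (mpltM lt (mplexx _) (mpfin_neq0 (b k0))).
      by rewrite -mulrA -mpfinD; apply: mpleM (mpltW Bk).
    apply: mplt_le_trans (mpleM le (mplexx (mpfin (b k0)))).
    by rewrite -mulrA -mpfinD; apply: mpltMr.
  have top0 : 0 <+ v k0 * mpfin (b k0).
    by rewrite mplt0 mpmul_eq0 negb_or vk0 mpfin_neq0.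
  have top : u (f k0) * B (f k0) (g k0) = v k0 * mpfin (b k0).
    by have := ab k0 k0; rewrite eqxx => ->; rewrite /v k0IJ mpfinD mulrA.
  have side (K L : {set 'I_m}) : f k0 \in K -> [disjoint K & L]%B ->
      (forall i, i \in L -> (i \in I) || (i \in J)) ->
      L \subset f @: 'I_r ->
      (\sum_(j in L) u j *: row j B) 0 (g k0) <+ (\sum_(i in K) u i *: row i B) 0 (g k0).
    move=> kK KL LIJ LS; rewrite !summxE.
    apply: (@mplt_le_trans _ (v k0 * mpfin (b k0))); last first.
      rewrite -top; have := mple_sum (fun i => (u i *: row i B) 0 (g k0)) kK.
      by rewrite !mxE.
    apply: mpsum_lt => // j jL; have /imsetP[k _ jk] := fintype.subsetP LS j jL.
    rewrite !mxE jk; apply: col; first by rewrite -jk LIJ.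
    apply: contraTneq jL => kk0; rewrite jk kk0.
    by have /pred0P/(_ (f k0)) := KL; rewrite /= kK /= => ->.
  case/orP: k0IJ => [kI|kJ].
    have := side I J kI IJ (fun i iJ => introT orP (or_intror iJ)) JS.
    by rewrite E mpltxx.
  have := side J I kJ _ (fun i iI => introT orP (or_introl iI)) IS.
  by rewrite E mpltxx disjoint_sym => /(_ IJ).
have := @leq_bigmax_cond _ (fun S : {set 'I_m} =>
  `[< gm_independent B S >]) (fun S => #|S|) (f @: 'I_r).
rewrite card_imset// card_ord; apply; exact/asboolP.
Qed.

End Dominant.

(** * Row rank and irredundant generating sets *)

Section WeakDim.
Context {R : realType} {n : nat}.
Local Notation T := (maxplus R).
Implicit Types (G H : {fset 'rV[T]_n}) (v w : 'rV[T]_n).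

Lemma tconv_mem G v : v \in G -> tconv G v.
Proof.
move=> vG; exists (fun s => (s == v)%:R).
rewrite (big_fsetD1 v)//= eqxx scale1r big_seq_cond big1 ?addr0// => s.
by rewrite andbT !inE => /andP[/negPf-> _]; rewrite scale0r.
Qed.

Lemma tconv0 G : tconv G 0.
Proof. by exists (fun=> 0); rewrite big1// => s _; rewrite scale0r. Qed.

Lemma tconvD G v w : tconv G v -> tconv G w -> tconv G (v + w).
Proof.
move=> [a ->] [b ->]; exists (fun s => a s + b s); rewrite -big_split.
by apply: eq_bigr => s _; rewrite scalerDl.
Qed.

Lemma tconvZ G (x : T) v : tconv G v -> tconv G (x *: v).
Proof.
move=> [a ->]; exists (fun s => x * a s); rewrite scaler_sumr.
by apply: eq_bigr => s _; rewrite scalerA.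
Qed.

Lemma tconv_sum G I (r : seq I) (P : pred I) (F : I -> 'rV[T]_n) :
  (forall i, P i -> tconv G (F i)) -> tconv G (\sum_(i <- r | P i) F i).
Proof.
move=> GF; elim/big_rec: _ => [|i v Pi Gv]; first exact: tconv0.
by apply: tconvD => //; apply: GF.
Qed.

Lemma tconv_sub G H : (forall s, s \in G -> tconv H s) -> tconv G `<=` tconv H.
Proof.
move=> GH v [a ->]; rewrite big_seq; apply: tconv_sum => s sG.
by apply/tconvZ/GH.
Qed.

Definition irredundant G := forall H, (H `<` G)%fset -> tconv H <> tconv G.

Lemma irredundant_notin G g : irredundant G -> g \in G -> ~ tconv (G `\ g)%fset g.
Proof.
move=> irr gG Gg; apply: (irr (G `\ g)%fset); first exact: fproperD1.
apply/seteqP; split; apply: tconv_sub => s.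
  by rewrite !inE => /andP[_]; exact: tconv_mem.
by have [->//|sg sG] := eqVneq s g; apply: tconv_mem; rewrite !inE sg.
Qed.

(** Write g with the generators H, and these with the generators G: g is a
    combination of elements of G. If the coefficient c of g in it is below 1, then
    g is the sum of the other terms, contrary to irredundancy.
    Otherwise some h in H satisfies b h <= g <= c g <= b h for its coefficient b. *)
Lemma irredundant_scaled_mem G H g : irredundant G -> tconv G = tconv H -> g \in G ->
  exists2 h, h \in H & exists r, g = mpfin r *: h.
Proof.
move=> irr GH gG.
have [b gb] : tconv H g by rewrite -GH; exact: tconv_mem.
have /choice[a aP] : forall h, exists a, h \in H -> h = \sum_(s <- G) a s *: s.
  move=> h; have [hH|_] := boolP (h \in H); last by exists (fun=> 0).
  by have : tconv G h; [rewrite GH; exact: tconv_mem|move=> [a]; exists a].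
(* the coefficients of g on G obtained through H *)
pose c s := \sum_(h <- H) b h * a h s.
have gc : g = \sum_(s <- G) c s *: s.
  rewrite {1}gb; under [RHS]eq_bigr do rewrite scaler_suml.
  rewrite exchange_big /= big_seq [RHS]big_seq; apply: eq_bigr => h hH.
  transitivity (b h *: \sum_(s <- G) a h s *: s); first by rewrite -aP.
  by rewrite scaler_sumr; apply: eq_bigr => s _; rewrite scalerA.
rewrite (big_fsetD1 g)//= in gc; set v := (\sum_(_ <- _) _) in gc.
have [c1|] := boolP (c g <+ 1).
  case: (irredundant_notin irr gG); exists c; apply/rowP => j.
  have : g 0 j = c g * g 0 j + v 0 j by rewrite {1}gc !mxE.
  rewrite -/v; set x := g 0 j; set y := v 0 j => xE.
  have [x0|x0] := eqVneq x 0.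
    apply/esym/mple_anti; last by rewrite x0.
    by rewrite [X in _ <=+ X]xE mple_addr.
  have lt : c g * x <+ 1 * x by apply: mpltM.
  case: (mpadd_eq (c g * x) y) => E; rewrite E in xE => //.
  by rewrite -xE mul1r mpltxx in lt.
rewrite -mpleNgt => c1.
have c0 : c g != 0 by apply: contraTneq c1 => ->; rewrite -mpltNge mplt0.
have [h hH cE] : exists2 h, h \in H & c g = b h * a h g.
  by move: c0; rewrite /c big_seq => /mpsum_attained.
exists h => //; case: (maxplusP (b h)) => [b0|r bE].
  by rewrite cE b0 mul0r eqxx in c0.
exists r; rewrite -bE; apply/rowP => j; rewrite mxE; apply: mple_anti.
  have : g 0 j <=+ c g * g 0 j by rewrite -[X in X <=+ _]mul1r; apply: mpleM.
  move=> /mple_trans; apply; rewrite cE -mulrA; apply: mpleM => //.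
  rewrite [X in _ <=+ X](congr1 (fun w : 'rV_n => w 0 j) (aP _ hH)) summxE.
  by have := mple_sum_seq (fun s => (a h s *: s) 0 j) gG; rewrite !mxE.
rewrite [X in _ <=+ X](congr1 (fun w : 'rV_n => w 0 j) gb) summxE.
by have := mple_sum_seq (fun s => (b s *: s) 0 j) hH; rewrite !mxE.
Qed.

Lemma irredundant_card_le G H : irredundant G -> tconv G = tconv H ->
  (#|` G| <= #|` H|)%N.
Proof.
move=> irr GH.
have /choice[p pP] : forall g, exists h, g \in G -> h \in H /\ exists r, g = mpfin r *: h.
  move=> g; have [gG|_] := boolP (g \in G); last by exists g.
  by have [h hH hr] := irredundant_scaled_mem irr GH gG; exists h.
have pinj : {in G &, injective p}.
  move=> g g' gG g'G pgg'; apply/eqP; apply: contraT => gg'.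
  have [_ [r gE]] := pP _ gG; have [_ [r' g'E]] := pP _ g'G.
  case: (irredundant_notin irr gG).
  rewrite [X in tconv _ X](_ : g = mpfin (r - r') *: g'); last first.
    by rewrite {1}gE pgg' [in RHS]g'E scalerA -mpfinD subrK.
  by apply/tconvZ/tconv_mem; rewrite in_fsetD1 (eq_sym g') gg' g'G.
rewrite -(size_map p); apply: uniq_leq_size.
  by rewrite map_inj_in_uniq ?fset_uniq.
by move=> _ /mapP[g gG ->]; have [] := pP _ gG.
Qed.

(** A generating set of least cardinality is irredundant, so the unspecified choice
    in the definition of the weak dimension is made in a nonempty set. *)
Lemma weak_dim_basis H : exists G,
  [/\ #|` G| = weak_dim (tconv H), tconv G = tconv H & irredundant G].
Proof.
pose P d := `[< exists G, #|` G| = d /\ tconv G = tconv H >].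
have Pex : exists d, P d by exists #|` H|; apply/asboolP; exists H.
case: (ex_minnP Pex) => d /asboolP[G [Gd GH]] dmin.
have [//|K [Kd KH Kirr]] := @xgetPex _ 0%N [set d |
  exists G : {fset 'rV[T]_n}, [/\ #|` G| = d, tconv G = tconv H &
    forall K : {fset 'rV[T]_n}, (K `<` G)%fset -> tconv K <> tconv H]].
  exists d, G; split=> // K KG KH.
  have : (#|` K| < #|` G|)%N by exact: fproper_ltn_card.
  by rewrite Gd ltnNge dmin//; apply/asboolP; exists K.
by exists K; split=> // L LK; rewrite KH; apply: Kirr.
Qed.

Lemma weak_dim_le H : (weak_dim (tconv H) <= #|` H|)%N.
Proof.
have [G [<- GH irr]] := weak_dim_basis H; exact: irredundant_card_le.
Qed.

End WeakDim.

Section RowRank.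
Context {R : realType}.
Local Notation T := (maxplus R).

(** The coefficients of the rows on a generating set, and this set, are the two
    factors. *)
Lemma schein_le_row_rank m n (A : 'M[T]_(m, n)) : (schein_rank A <= row_rank A)%N.
Proof.
rewrite /row_rank; have [G [<- GA _]] := weak_dim_basis [fset row i A | i in 'I_m]%fset.
have /choice[a aP] i : exists a : 'rV[T]_n -> T, row i A = \sum_(s <- G) a s *: s.
  suff : tconv G (row i A) by [].
  by rewrite GA; apply: tconv_mem; apply: in_imfset.
rewrite (_ : A = \matrix_(i < m, k < #|` G|) a i (nth 0 G k) *m
                 \matrix_(k < #|` G|, j < n) (nth 0 G k : 'rV_n) 0 j).
  exact: schein_le.
apply/matrixP => i j; have := congr1 (fun v : 'rV_n => v 0 j) (aP i).
rewrite !mxE => ->; rewrite (big_nth 0) big_mkord summxE.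
by apply: eq_bigr => k _; rewrite !mxE.
Qed.

Lemma row_rank_le m n (A : 'M[T]_(m, n)) (X : {set 'I_m}) :
  (forall i, exists a : 'I_m -> T, row i A = \sum_(x in X) a x *: row x A) ->
  (row_rank A <= #|X|)%N.
Proof.
move=> AX; pose H := [fset row x A | x in X]%fset.
have -> : row_rank A = weak_dim (tconv H).
  congr (weak_dim _); apply/seteqP; split; apply: tconv_sub => s /imfsetP[i /= iX ->].
    have [a ->] := AX i; apply: tconv_sum => x xX; apply/tconvZ/tconv_mem.
    exact: in_imfset.
  by apply: tconv_mem; apply: in_imfset.
apply: leq_trans (weak_dim_le _) _.
rewrite cardE; exact: leq_imfset_card.
Qed.

End RowRank.

(** * Weights of paths and circuits *)

Section PathWeights.
Context {R : realType} {n : nat}.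
Local Notation T := (maxplus R).
Implicit Types (A B : 'M[T]_n) (i j : 'I_n) (p q c : seq 'I_n).

Fixpoint path_weight B i p : T :=
  if p is k :: p' then B i k * path_weight B k p' else 1.

Lemma path_weight_cat B i p q :
  path_weight B i (p ++ q) = path_weight B i p * path_weight B (last i p) q.
Proof. by elim: p i => [|k p IH] i /=; rewrite ?mul1r// IH mulrA. Qed.

Lemma powS B k i j : (B ^+ k.+1) i j = \sum_l B i l * (B ^+ k) l j.
Proof. by rewrite exprS mxE. Qed.

Lemma powD B k l i j : (B ^+ (k + l)) i j = \sum_h (B ^+ k) i h * (B ^+ l) h j.
Proof. by rewrite exprD mxE. Qed.

Lemma pow0 B i j : (B ^+ 0) i j = (i == j)%:R.
Proof. by rewrite expr0 mxE. Qed.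

Lemma pow_ge B k l i h j : (B ^+ k) i h * (B ^+ l) h j <=+ (B ^+ (k + l)) i j.
Proof.
rewrite powD.
exact: (mple_sum (P := xpredT) (fun h => (B ^+ k) i h * (B ^+ l) h j)).
Qed.

Lemma path_weight_le B i p : path_weight B i p <=+ (B ^+ size p) i (last i p).
Proof.
elim: p i => [|k p IH] i /=; first by rewrite pow0 eqxx.
apply: mple_trans (mpleM (mplexx _) (IH k)) _.
rewrite powS; exact: (mple_sum (P := xpredT) (fun l => B i l * (B ^+ size p) l (last k p))).
Qed.

Lemma pow_path B k i j : (B ^+ k) i j != 0 ->
  exists p, [/\ size p = k, last i p = j & path_weight B i p = (B ^+ k) i j].
Proof.
elim: k i => [|k IH] i.
  by rewrite pow0; have [->|] := eqVneq i j; rewrite ?eqxx//; exists [::].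
rewrite powS => S0; have [l _ lE] := mpsum_attained S0.
move: S0; rewrite lE mpmul_eq0 negb_or.
move=> /andP[Bil /IH[p [<- <- pE]]]; exists (l :: p); split=> //=.
by rewrite pE.
Qed.

(** A path with n arcs visits some vertex twice. *)
Lemma path_loop i p : size p = n -> exists q1 q2 q3,
  [/\ p = q1 ++ q2 ++ q3, q2 != [::] & last (last i q1) q2 = last i q1].
Proof.
move=> sp; have /(uniqPn i)[a [b [ab bs abE]]] : ~~ uniq (i :: p).
  apply/negP => /card_uniqP => c; have := max_card (mem (i :: p)).
  by rewrite c /= sp card_ord ltnn.
have nthl k : (k <= size p)%N -> nth i (i :: p) k = last i (take k p).
  move=> kp; rewrite (last_nth i) size_takel//.
  by rewrite -[i :: take k p]/(take k.+1 (i :: p)) nth_take.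
rewrite /= ltnS in bs.
rewrite !nthl// in abE; last exact: leq_trans (ltnW ab) bs.
exists (take a p), (take (b - a) (drop a p)), (drop b p); split.
- have -> : drop b p = drop (b - a) (drop a p).
    by rewrite drop_drop subnK// ltnW.
  by rewrite !cat_take_drop.
- by rewrite -size_eq0 size_takel ?size_drop ?leq_sub2r// subn_eq0 -ltnNge.
- rewrite -last_cat abE; congr last.
  by rewrite -takeD subnKC// ltnW.
Qed.

Definition circuit_weight A c : T := \prod_(a <- circuit_arcs c) A a.1 a.2.

Lemma circuit_weightE A i p : circuit_weight A (i :: p) = path_weight A i (rcons p i).
Proof.
rewrite /circuit_weight /circuit_arcs rot1_cons.
elim: p {1 3}i => [|k p IH] j /=; first by rewrite big_seq1 mulr1.
by rewrite big_cons IH.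
Qed.

Lemma mpval_prod I (r : seq I) (f : I -> T) :
  mpval (\prod_(i <- r) f i) = (\sum_(i <- r) (f i : \bar R))%E.
Proof. by rewrite (big_morph (@mpval R) (id1 := 0%E) (op1 := adde)). Qed.

Lemma mean_weight_fin A c w : c != [::] -> circuit_weight A c = mpfin w ->
  mean_weight A c = (w / (size c)%:R)%:E.
Proof.
move=> c0 cw.
by rewrite /mean_weight -mpval_prod -/(circuit_weight A c) cw EFinM.
Qed.

Lemma mean_weight_null A c : c != [::] -> circuit_weight A c = 0 ->
  mean_weight A c = -oo%E.
Proof.
move=> c0 cw; rewrite /mean_weight -mpval_prod -/(circuit_weight A c) cw.
by rewrite gt0_mulNye// lte_fin invr_gt0 ltr0n lt0n size_eq0.
Qed.

Lemma mean_weight_le_rho A c : c != [::] -> (size c <= n)%N ->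
  (mean_weight A c <= rho A)%E.
Proof.
move=> c0 cn; rewrite /rho.
have : size c \in index_iota 1 n.+1 by rewrite mem_index_iota lt0n size_eq0 c0 ltnS.
move=> /(@bigmax_sup_seq _ _ _ _ _ (size c)); apply => //.
by have := @le_bigmax _ _ _ -oo%E
  (fun t : (size c).-tuple 'I_n => mean_weight A t) (in_tuple c).
Qed.

Lemma rho_attained A : rho A = -oo%E \/
  exists c, [/\ c != [::], (size c <= n)%N & rho A = mean_weight A c].
Proof.
rewrite /rho big_nat; elim/big_ind: _ => [|x y hx hy|k /andP[k0 kn]]; first by left.
  by rewrite /maxe; case: ifP.
elim/big_ind: _ => [|x y hx hy|c _]; [by left|by rewrite /maxe; case: ifP|].
by right; exists c; rewrite -size_eq0 size_tuple -lt0n.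
Qed.

End PathWeights.

(** * Strict visualisation *)

Section Visualisation.
Context {R : realType} {n : nat}.
Local Notation T := (maxplus R).
Implicit Types (A B : 'M[T]_n) (i j : 'I_n) (p q c : seq 'I_n).

(** When no circuit has positive weight, this is the Kleene star of B: loops can be
    removed from paths without decreasing weights. *)
Definition star B : 'M[T]_n := \matrix_(i, j) \sum_(k < n) (B ^+ k) i j.

Lemma loop_circuit B i q : q != [::] -> last i q = i -> exists c,
  [/\ c != [::], size c = size q & path_weight B i q = circuit_weight B c].
Proof.
case/lastP: q => // q j _; rewrite last_rcons => ->; exists (i :: q).
by rewrite size_rcons circuit_weightE.
Qed.

Lemma pow_le_star B :
  (forall c, c != [::] -> (size c <= n)%N -> circuit_weight B c <=+ 1) ->
  forall k i j, (k <= n)%N -> (B ^+ k) i j <=+ star B i j.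
Proof.
move=> circ k i j; rewrite leq_eqVlt => /orP[/eqP->|kn]; last first.
  rewrite mxE; exact: (mple_sum (P := xpredT)
    (fun k : 'I_n => (B ^+ k) i j) (j := Ordinal kn)).
have [->//|/pow_path[p [sp lp <-]]] := eqVneq ((B ^+ n) i j) 0.
have [q1 [q2 [q3 [pE q20 q2l]]]] := path_loop i sp.
have sn : (size (q1 ++ q3) < n)%N.
  apply: leq_trans (eq_leq sp); rewrite pE !size_cat ltn_add2l.
  by rewrite -[X in (X < _)%N]add0n ltn_add2r lt0n size_eq0.
have q2w : path_weight B (last i q1) q2 <=+ 1.
  have [c [c0 cs ->]] := loop_circuit B q20 q2l; apply: circ => //.
  by apply: leq_trans (eq_leq sp); rewrite cs pE !size_cat addnCA leq_addr.
apply: (@mple_trans _ (path_weight B i (q1 ++ q3))).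
  rewrite pE !path_weight_cat q2l mulrA; apply: mpleM => //.
  by rewrite -[X in _ <=+ X]mulr1; apply: mpleM.
apply: mple_trans (path_weight_le B i (q1 ++ q3)) _.
have -> : last i (q1 ++ q3) = j by rewrite -lp pE !last_cat q2l.
rewrite mxE; exact: (mple_sum (P := xpredT)
    (fun k : 'I_n => (B ^+ k) i j) (j := Ordinal sn)).
Qed.

Lemma pow_star_le B :
  (forall c, c != [::] -> (size c <= n)%N -> circuit_weight B c <=+ 1) ->
  forall k i j, (B ^+ k) i j <=+ star B i j.
Proof.
move=> circ k i j; elim: k i => [|k IH] i; first exact: pow_le_star circ _ _ _ _.
rewrite powS; apply: mpsum_le => l _.
apply: mple_trans (mpleM (mplexx _) (IH l)) _.
rewrite mxE mulr_sumr; apply: mpsum_le => h _.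
apply: (mple_trans _ _ (pow_le_star circ i j (ltn_ord h))).
rewrite powS; exact: (mple_sum (P := xpredT) (fun l => B i l * (B ^+ h) l j)).
Qed.

(** The row sums of the star form a finite vector x with B x <= x. *)
Lemma potential B :
  (forall c, c != [::] -> (size c <= n)%N -> circuit_weight B c <=+ 1) ->
  exists p : 'I_n -> R, forall i j, B i j <=+ mpfin (p i - p j).
Proof.
move=> circ; pose x i := \sum_j star B i j.
have x0 i : x i != 0.
  have : 1 <=+ x i.
    apply: mple_trans (mple_sum (P := xpredT) (star B i) (j := i) _) => //.
    by have := pow_star_le circ 0 i i; rewrite pow0 eqxx.
  by apply: contraTneq => ->; rewrite -mpltNge mplt0.
have /choice[p pP] : forall i, exists r, x i = mpfin r.
  move=> i; case: (maxplusP (x i)) => [xi0|r]; last by exists r.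
  by have := x0 i; rewrite xi0 eqxx.
exists p => i j; rewrite mpfinD -pP.
suff le : B i j * x j <=+ x i.
  have := mpleM le (mplexx (mpfin (- p j))).
  by rewrite -mulrA (pP j) -mpfinD subrr mulr1.
rewrite /x mulr_sumr; apply: mpsum_le => l _.
apply: (@mple_trans _ (star B i l)); last exact: mple_sum.
rewrite [star B j l]mxE mulr_sumr; apply: mpsum_le => k _.
apply: (mple_trans _ _ (pow_star_le circ k.+1 i l)).
rewrite powS; exact: (mple_sum (P := xpredT) (fun h => B i h * (B ^+ k) h l)).
Qed.

Lemma common_gap (I : finType) (P : I -> R -> Prop) :
  (forall i : I, exists2 e, 0 < e & P i e) ->
  (forall (i : I) e e', P i e -> e' <= e -> P i e') ->
  exists2 e, 0 < e & forall i : I, P i e.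
Proof.
move=> Pex Pdown.
have /fin_all_exists2[e e0 eP] := Pex.
exists (\big[Num.min/1]_i e i); first exact: lt_bigmin.
by move=> i; apply: Pdown (eP i) _; apply: bigmin_le_cond.
Qed.

Lemma path_weight_neq0 A i q : (path_weight A i q != 0) = path (arc_rel A) i q.
Proof. by elim: q i => //= k q IH i; rewrite mpmul_eq0 negb_or IH. Qed.

Lemma circuit_weight_neq0 A c : c != [::] ->
  (circuit_weight A c != 0) = path.cycle (arc_rel A) c.
Proof. by case: c => // i p _; rewrite circuit_weightE path_weight_neq0. Qed.

Lemma circuit_weight_scale A B (x : T) c :
  (forall a, a \in circuit_arcs c -> B a.1 a.2 <=+ x * A a.1 a.2) ->
  circuit_weight B c <=+ x ^+ size c * circuit_weight A c.
Proof.
rewrite /circuit_weight -(size1_zip (t := rot 1 c) (s := c)) ?size_rot//.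
rewrite -/(circuit_arcs c); elim: (circuit_arcs c) => [|a r IH] AB.
  by rewrite !big_nil mul1r.
rewrite !big_cons exprS mulrACA; apply: mpleM; first by apply: AB; rewrite mem_head.
by apply: IH => b br; apply: AB; rewrite inE br orbT.
Qed.

Lemma circuit_potential (p : 'I_n -> R) c :
  \sum_(a <- circuit_arcs c) (p a.1 - p a.2) = 0.
Proof.
rewrite sumrB /circuit_arcs.
rewrite -(big_map fst xpredT p) -(big_map snd xpredT p).
rewrite -!/(unzip1 _) -!/(unzip2 _) unzip1_zip ?unzip2_zip ?size_rot//.
by rewrite [X in _ - X](perm_big c) ?subrr//= perm_rot.
Qed.

(** Normalise the maximal circuit mean to 0. There are finitely many circuits of length
    at most n, so those of negative weight are bounded away from 0, and the arcs
    outside the critical graph can be increased by some eps > 0 while no circuit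
    becomes positive. A potential of the increased matrix leaves a slack eps outside
    the critical graph; inside it there is no slack, as the potential differences
    around a critical circuit add up to 0. *)
Lemma strict_visualisation A lam : rho A = lam%:E ->
  exists (p : 'I_n -> R) (eps : R),
  0 < eps /\ forall i j,
    if crit_arc A i j then A i j = mpfin (lam + (p i - p j))
    else A i j <=+ mpfin (lam + (p i - p j) - eps).
Proof.
move=> rhoA.
have n0 : n%:R >= 0 :> R by [].
have [eps eps0 gap] : exists2 eps, 0 < eps & forall k : 'I_n, forall c : k.+1.-tuple 'I_n,
    circuit_weight A c <+ mpfin (lam *+ k.+1) ->
    circuit_weight A c <=+ mpfin (lam *+ k.+1 - n%:R * eps).
  apply: common_gap => [k|k e e' ke e'e c /ke cw]; last first.
    apply: mple_trans cw _; rewrite mple_fin lerB//.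
    by rewrite ler_wpM2l.
  apply: common_gap => [c|c e e' ce e'e /ce cw]; last first.
    apply: mple_trans cw _; rewrite mple_fin lerB//.
    by rewrite ler_wpM2l.
  case: (maxplusP (circuit_weight A c)) => [->|w ->]; first by exists 1.
  have [lt|] := boolP (mpfin w <+ mpfin (lam *+ k.+1)); last by exists 1.
  have np : 0 < n%:R :> R by rewrite ltr0n (leq_ltn_trans _ (ltn_ord k)).
  rewrite mplt_fin in lt; exists ((lam *+ k.+1 - w) / n%:R).
    by rewrite divr_gt0// subr_gt0.
  by move=> _; rewrite mple_fin mulrC divfK ?gt_eqF// subKr.
(* the normalised matrix, increased by eps outside the critical graph *)
pose B : 'M[T]_n := \matrix_(i, j)
  (mpfin (if crit_arc A i j then - lam else eps - lam) * A i j).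
have Ble c : c != [::] -> (size c <= n)%N -> circuit_weight A c <=+ mpfin (lam *+ size c).
  move=> c0 cn; have := mean_weight_le_rho A c0 cn; rewrite rhoA.
  case: (maxplusP (circuit_weight A c)) => [->//|w wE].
  rewrite (mean_weight_fin c0 wE) lee_fin wE mple_fin ler_pdivrMr ?mulr_natr//.
  by rewrite ltr0n lt0n size_eq0.
have critE c : c != [::] -> circuit_weight A c = mpfin (lam *+ size c) -> critical A c.
  move=> c0 cw; rewrite /critical /circuit c0 /= -circuit_weight_neq0// cw mpfin_neq0 /=.
  rewrite (mean_weight_fin c0 cw) rhoA -[lam *+ _]mulr_natr mulfK// pnatr_eq0 size_eq0//.
have critW c : critical A c -> c != [::] /\ circuit_weight A c = mpfin (lam *+ size c).
  move=> /andP[/andP[c0 _] /eqP wrho]; split=> //.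
  case: (maxplusP (circuit_weight A c)) => [cw|w cw].
    by move: wrho; rewrite (mean_weight_null c0 cw) rhoA.
  move: wrho; rewrite (mean_weight_fin c0 cw) rhoA => -[<-].
  rewrite cw -(mulr_natr (w / _)) divfK// pnatr_eq0 size_eq0//.
have circB c : c != [::] -> (size c <= n)%N -> circuit_weight B c <=+ 1.
  move=> c0 cn; have [lt|] := boolP (circuit_weight A c <+ mpfin (lam *+ size c)).
    have cw : circuit_weight A c <=+ mpfin (lam *+ size c - n%:R * eps).
      have sc : (0 < size c)%N by rewrite lt0n size_eq0.
      have kn : ((size c).-1 < n)%N by rewrite prednK.
      have st : size c == (size c).-1.+1 by rewrite prednK.
      have := gap (Ordinal kn) (Tuple st); rewrite /= prednK//; exact.
    have := circuit_weight_scale (A := A) (B := B) (x := mpfin (eps - lam)) (c := c).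
    move=> /(_ _)/mple_trans; apply.
      move=> a _; rewrite mxE; apply: mpleM => //; rewrite mple_fin.
      by case: ifP => _; lra.
    rewrite mpfinX; apply: mple_trans (mpleM (mplexx _) cw) _.
    rewrite -mpfinD -mpfin0 mple_fin mulrnBl.
    suff : eps *+ size c <= n%:R * eps by lra.
    by rewrite -[eps *+ _]mulr_natl ler_wpM2r ?ler_nat// ltW.
  rewrite -mpleNgt => ge; have cw := mple_anti (Ble c c0 cn) ge.
  have cc := critE _ c0 cw.
  have := circuit_weight_scale (A := A) (B := B) (x := mpfin (- lam)) (c := c).
  move=> /(_ _)/mple_trans; apply.
    move=> [i j] ac; rewrite mxE (_ : crit_arc A i j)//.
    by apply/asboolP; exists c.
  by rewrite cw mpfinX -mpfinD mulNrn addNr.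
have [p pB] := potential circB.
exists p, eps; split=> // i j.
have le k l : A k l <=+ mpfin (lam + (p k - p l) - if crit_arc A k l then 0 else eps).
  have := mpleM (mplexx (mpfin (- (if crit_arc A k l then - lam else eps - lam)))) (pB k l).
  rewrite mxE mulrA -!mpfinD addNr mul1r => /mple_trans; apply.
  by rewrite mple_fin; case: ifP => _; lra.
have := le i j; case: ifP => // ijc; rewrite subr0 => leij.
have /asboolP[c cc ijin] := ijc.
have [c0 cw] := critW _ cc.
(* a strict inequality on one arc of a critical circuit would make its weight
   smaller than lam times its length *)
apply/eqP; apply: contraT => ne.
have lt : A i j <+ mpfin (lam + (p i - p j)) by rewrite mplt_neqAle ne.
have : circuit_weight A c <+ \prod_(a <- circuit_arcs c) mpfin (lam + (p a.1 - p a.2)).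
  rewrite /circuit_weight; elim: (circuit_arcs c) ijin => // a r IH.
  have le' k l : A k l <=+ mpfin (lam + (p k - p l)).
    by apply: mple_trans (le k l) _; rewrite mple_fin; case: ifP => _; lra.
  rewrite inE !big_cons => /predU1P[<-|/IH{}IH].
    apply: mpltM => //; last by rewrite mpfin_prod mpfin_neq0.
    by elim/big_rec2: _ => // b x y _; apply: mpleM.
  by apply: mpltMr.
rewrite mpfin_prod big_split /= circuit_potential addr0 big_const_seq.
rewrite count_predT size1_zip ?size_rot// -/(lam *+ _) cw.
by rewrite iter_addr_0 mpltxx.
Qed.

End Visualisation.

(** * Large powers of a visualised matrix *)

Section Visualised.
Context {R : realType} {n : nat}.
Local Notation T := (maxplus R).
Implicit Types (i j : 'I_n) (k m t : nat).
Variables (e : rel 'I_n) (W : 'M[T]_n) (eps : R).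
Hypothesis eps0 : 0 < eps.
Hypothesis vis : forall i j, if e i j then W i j = 1 else W i j <=+ mpfin (- eps).

Let eps1 : mpfin (- eps) <=+ (1 : T).
Proof. by rewrite -mpfin0 mple_fin oppr_le0 ltW. Qed.

(** All entries of W are at most 1, the walks of e have weight 1, and any other walk has
    an arc of weight at most - eps. *)
Lemma vis_pow t i j :
  if walk e t i j then (W ^+ t) i j = 1 else (W ^+ t) i j <=+ mpfin (- eps).
Proof.
suff [le1 wE] : (W ^+ t) i j <=+ 1 /\
    if walk e t i j then 1 <=+ (W ^+ t) i j else (W ^+ t) i j <=+ mpfin (- eps).
  by move: wE; case: ifP => // _ ge1; apply: mple_anti.
have W1 h l : W h l <=+ 1.
  by have := vis h l; case: ifP => [_ ->//|_ /mple_trans]; apply.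
elim: t i => [|t IH] i /=; first by rewrite pow0; case: eqP.
rewrite powS; split.
  by apply: mpsum_le => l _; rewrite -[1]mulr1; apply: mpleM => //; have [] := IH l.
case: ifPn => [/existsP[l /andP[il lj]]|/existsPn nw].
  have [_] := IH l; rewrite lj => ge1.
  have := vis i l; rewrite il => il1.
  apply: mple_trans ge1 _; rewrite -[X in X <=+ _]mul1r -il1.
  exact: (mple_sum (P := xpredT) (fun l => W i l * (W ^+ t) l j)).
apply: mpsum_le => l _; have [lj1 lj] := IH l; have := nw l; have := vis i l.
case: (e i l) => /= [-> /negPf lj0|il _]; first by rewrite lj0 mul1r in lj *.
by rewrite -[mpfin _]mulr1; apply: mpleM.
Qed.

Lemma vis_pow_walk t i j : walk e t i j -> (W ^+ t) i j = 1.
Proof. by have := vis_pow t i j => + w; rewrite w. Qed.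

Lemma vis_pow_le1 t i j : (W ^+ t) i j <=+ 1.
Proof. by have := vis_pow t i j; case: ifP => [_ ->//|_ /mple_trans]; apply. Qed.

Hypothesis back : forall i j, e i j -> connect e j i.
Context (L : nat) (L0 : (0 < L)%N) (Lwalk : forall i, node e i -> walk e L i i).

Lemma vis_pow_walkr t s i j (k : 'I_n) :
  walk e s j k -> (W ^+ t) i j <=+ (W ^+ (t + s)) i k.
Proof. by move=> /vis_pow_walk jk; have := pow_ge W t s i j k; rewrite jk mulr1. Qed.

Lemma vis_pow_walkl t s i j (k : 'I_n) :
  walk e s i j -> (W ^+ t) j k <=+ (W ^+ (s + t)) i k.
Proof. by move=> /vis_pow_walk ij; have := pow_ge W s t i j k; rewrite ij mul1r. Qed.

(** A walk that meets a vertex c of e splits at c; one that avoids all of them loses eps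
    at each step. *)
Lemma vis_pow_split m i j : (W ^+ m) i j <=+ mpfin (- (eps *+ m)) +
  \sum_(c | node e c) \sum_(a < m.+1) (W ^+ a) i c * (W ^+ (m - a)) c j.
Proof.
elim: m i => [|m IH] i.
  apply: mple_trans (mple_addl _ _); rewrite mulr0n oppr0; exact: vis_pow_le1.
have [Ni|nNi] := boolP (node e i).
  apply: mple_trans (mple_addr _ _).
  apply: mple_trans (mple_sum _ Ni).
  have := mple_sum (P := xpredT)
    (fun a : 'I_m.+2 => (W ^+ a) i i * (W ^+ (m.+1 - a)) i j) (j := ord0).
  by rewrite pow0 eqxx mul1r subn0; apply.
rewrite powS; apply: mpsum_le => l _.
have il : W i l <=+ mpfin (- eps).
  by have := vis i l; case: ifP => // il _; case/existsP: nNi; exists l.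
apply: mple_trans (mpleM (mplexx _) (IH l)) _; rewrite mulrDr mple_add.
apply/andP; split.
  apply: mple_trans (mple_addl _ _); apply: mple_trans (mpleM il (mplexx _)) _.
  by rewrite -mpfinD mple_fin mulrS opprD.
apply: mple_trans (mple_addr _ _); rewrite mulr_sumr; apply: mpleS => c Nc.
rewrite mulr_sumr; apply: mpsum_le => a _.
have := mple_sum (P := xpredT)
  (fun a : 'I_m.+2 => (W ^+ a) i c * (W ^+ (m.+1 - a)) c j) (j := lift ord0 a) isT.
rewrite /= subSS; apply: mple_trans; rewrite mulrA; apply: mpleM => //.
rewrite powS; exact: (mple_sum (P := xpredT) (fun l => W i l * (W ^+ a) l c)).
Qed.

(** The left-hand side is at most the star of W ^+ L, that is, the maximum of the first n
    powers, and waiting at c along closed walks of e makes these powers increase. *)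
Lemma eventual_pow_col k i c : node e c -> (W ^+ (L * k)) i c <=+ (W ^+ (L * n)) i c.
Proof.
move=> Nc; rewrite exprM; apply: mple_trans (pow_star_le _ _ _ _) _.
  move=> q _ _; rewrite /circuit_weight; elim/big_rec: _ => // a x _ x1.
  by rewrite -[1]mulr1; apply: mpleM => //; exact: vis_pow_le1.
rewrite mxE; apply: mpsum_le => l _; rewrite -exprM.
have -> : (L * n = L * l + L * (n - l))%N by rewrite -mulnDr subnKC// ltnW.
by apply: vis_pow_walkr; rewrite mulnC; apply: walk_mul; exact: Lwalk.
Qed.

Lemma eventual_pow_row k c j : node e c -> (W ^+ (L * k)) c j <=+ (W ^+ (L * n)) c j.
Proof.
move=> Nc; rewrite exprM; apply: mple_trans (pow_star_le _ _ _ _) _.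
  move=> q _ _; rewrite /circuit_weight; elim/big_rec: _ => // a x _ x1.
  by rewrite -[1]mulr1; apply: mpleM => //; exact: vis_pow_le1.
rewrite mxE; apply: mpsum_le => l _; rewrite -exprM.
have -> : (L * n = L * (n - l) + L * l)%N by rewrite -mulnDr subnK// ltnW.
by apply: vis_pow_walkl; rewrite mulnC; apply: walk_mul; exact: Lwalk.
Qed.

Let Q := W ^+ (L * n).

(** The limit of the matrices W ^+ (L * k): the optimal long walks pass through a
    vertex of e. *)
Definition spectral_projector : 'M[T]_n :=
  \matrix_(i, j) \sum_(c | node e c) Q i c * Q c j.
Let P := spectral_projector.

Lemma projector_le_pow k i j : (n + n <= k)%N -> P i j <=+ (W ^+ (L * k)) i j.
Proof.
move=> nk; rewrite mxE; apply: mpsum_le => c Nc.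
have nk' : (n <= k)%N by apply: leq_trans nk; exact: leq_addr.
have -> : (L * k = L * n + L * (k - n))%N by rewrite -mulnDr subnKC.
apply: mple_trans (pow_ge _ _ _ _ _ _).
apply: mpleM => //.
have nkn : (n <= k - n)%N by rewrite leq_subRL.
rewrite -(subnK nkn) mulnDr; apply: vis_pow_walkl.
by rewrite mulnC; apply: walk_mul; exact: Lwalk.
Qed.

(** A walk of length L * k through a vertex c of e can be cut into pieces of lengths
    divisible by L: insert at c a walk of e to some c' and back, which costs nothing,
    and cut at c'. *)
Lemma pow_le_projector k i j :
  (W ^+ (L * k)) i j <=+ mpfin (- (eps *+ k)) + P i j.
Proof.
apply: mple_trans (vis_pow_split _ _ _) _; rewrite mple_add; apply/andP; split.
  apply: mple_trans (mple_addl _ _); rewrite mple_fin lerN2.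
  by apply: ler_wpMn2l; [exact: ltW|exact: leq_pmull].
apply: mple_trans (mple_addr _ _); apply: mpsum_le => c Nc.
apply: mpsum_le => a _.
(* c' is reached from c in L.-1 * a steps, so that a plus this number is L * a *)
have [c' cc'] := node_walk_all back (L.-1 * a) Nc.
have Nc' := node_walk back Nc cc'.
have [t tE c'c] : mwalk e L (L.-1 * (L.-1 * a)) c' c.
  by apply: mwalk_return => //; exists (L.-1 * a)%N.
have aE : (a + L.-1 * a = L * a)%N by rewrite -mulSn prednK.
have /dvdnP[q qE] : (L %| t + (L * k - a))%N.
  have ak : (a <= L * k)%N by rewrite -ltnS ltn_ord.
  rewrite /dvdn -modnDml tE modnDml -(modnMDl a).
  have key p b x : (x + b = p.+1 * k ->
      b * p.+1 + (p * (p * b) + x) = (p * b + k) * p.+1)%N.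
    by move=> E; rewrite mulnDl [(k * _)%N]mulnC -E !mulnS !mulnA; lia.
  have := key L.-1 a (L * k - a)%N; rewrite prednK// => ->; last exact: subnK.
  by rewrite modnMl.
apply: (@mple_trans _ (Q i c' * Q c' j)); last first.
  by rewrite mxE; apply: (mple_sum (fun c => Q i c * Q c j)).
apply: mpleM.
  apply: mple_trans (vis_pow_walkr a i cc') _.
  by rewrite aE; apply: eventual_pow_col.
apply: mple_trans (vis_pow_walkl (L * k - a) j c'c) _.
by rewrite qE mulnC; apply: eventual_pow_row.
Qed.

Lemma projector_col c i : node e c -> P i c = Q i c.
Proof.
move=> Nc; apply: mple_anti; rewrite mxE.
  apply: mpsum_le => c' Nc'; apply: mple_trans (pow_ge _ _ _ _ _ _) _.
  by rewrite -mulnDr; apply: eventual_pow_col.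
have := mple_sum (fun c' => Q i c' * Q c' c) Nc.
by rewrite /Q (vis_pow_walk (i := c)) ?mulr1// mulnC; apply/walk_mul/Lwalk.
Qed.

Lemma projector_row c j : node e c -> P c j = Q c j.
Proof.
move=> Nc; apply: mple_anti; rewrite mxE.
  apply: mpsum_le => c' Nc'; apply: mple_trans (pow_ge _ _ _ _ _ _) _.
  by rewrite -mulnDr; apply: eventual_pow_row.
have := mple_sum (fun c' => Q c c' * Q c' j) Nc.
by rewrite {1}/Q (vis_pow_walk (i := c)) ?mul1r// mulnC; apply/walk_mul/Lwalk.
Qed.

Lemma projector_diag c : node e c -> P c c = 1.
Proof.
move=> Nc; rewrite projector_col// /Q vis_pow_walk//.
by rewrite mulnC; apply/walk_mul/Lwalk.
Qed.

Lemma eventual_col_cong c d i : node e d -> mwalk e L 0 c d -> Q i c <=+ Q i d.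
Proof.
move=> Nd [t /eqP t0 cd]; apply: mple_trans (vis_pow_walkr (L * n) i cd) _.
rewrite mod0n in t0; have /dvdnP[q ->] := t0.
by rewrite [(q * L)%N]mulnC -mulnDr; apply: eventual_pow_col.
Qed.

Lemma eventual_row_cong c d j : node e d -> mwalk e L 0 d c -> Q c j <=+ Q d j.
Proof.
move=> Nd [t /eqP t0 dc]; apply: mple_trans (vis_pow_walkl (L * n) j dc) _.
rewrite mod0n in t0; have /dvdnP[q ->] := t0.
by rewrite [(q * L)%N]mulnC -mulnDr; apply: eventual_pow_row.
Qed.

(** Vertices joined by walks of e of length divisible by L have the same eventual rows
    and columns, so one vertex for each class suffices. *)
Lemma projector_reps i j : P i j = \sum_(x in reps e L) P i x * P x j.
Proof.
transitivity (\sum_(x in reps e L) Q i x * Q x j); last first.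
  by apply: eq_bigr => x /(reps_node back) Nx; rewrite projector_col ?projector_row.
rewrite mxE; apply: mple_anti; apply: mpsum_le => c.
  move=> Nc; have [x xX cx] := reps_cover L Nc.
  have Nx := reps_node back xX.
  apply: (@mple_trans _ (Q i x * Q x j)).
    apply: mpleM; first exact: eventual_col_cong.
    by apply: eventual_row_cong => //; exact: mwalk0_sym.
  exact: (mple_sum (fun x => Q i x * Q x j)).
move=> /(reps_node back) Nc; exact: (mple_sum (fun x => Q i x * Q x j)).
Qed.

End Visualised.

(** * Limits of projective classes *)

Section Topology.
Context {R : realType} {n : nat}.
Local Notation T := (maxplus R).
Implicit Types (A B : 'M[T]_n) (i j k l : 'I_n).

Lemma nbhs_mpval (x : T) (V : set (\bar R)) :
  nbhs (x : \bar R) V -> nbhs x (@mpval R @^-1` V).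
Proof. by move=> xV; apply: (@initial_continuous T _ (@mpval R) x). Qed.

Lemma nbhs_mpval_ex (x : T) (V : set T) : nbhs x V ->
  exists2 U : set (\bar R), nbhs (x : \bar R) U & @mpval R @^-1` U `<=` V.
Proof.
rewrite nbhsE => -[_ [[U oU <-] Ux] UV].
by exists U => //; exact: open_nbhs_nbhs.
Qed.

Lemma nbhs_coord B i j (V : set T) : nbhs (B i j) V ->
  nbhs B [set B' : 'M[T]_n | V (B' i j)].
Proof.
move=> BV.
exists (fun i' j' => if (i' == i) && (j' == j) then V else setT) => [i' j'|B' B'V].
  by case: andP => [[/eqP-> /eqP->]//|_]; exact: filterT.
by have := B'V i j; rewrite !eqxx.
Qed.

Lemma near_mple_fin B (a b : R) i j k l : mpfin b * B k l <+ mpfin a * B i j ->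
  nbhs B [set B' : 'M[T]_n | mpfin b * B' k l <+ mpfin a * B' i j].
Proof.
move=> lt.
have [r [rlo rhi]] : exists r, B k l <+ mpfin (r - b) /\ mpfin (r - a) <+ B i j.
  case: (maxplusP (B i j)) lt => [->|y ->]; first by rewrite mulr0 mpltNge mple0.
  case: (maxplusP (B k l)) => [->|z ->]; rewrite -?mpfinD ?mplt_fin => lt.
    by exists (a + y - 1); rewrite mplt0 mplt_fin; split=> //; lra.
  by exists ((a + y + b + z) / 2); rewrite !mplt_fin; split; lra.
have near1 : nbhs B [set B' : 'M[T]_n | B' k l <+ mpfin (r - b)].
  apply: (nbhs_coord (V := [set x | x <+ mpfin (r - b)])).
  apply: (nbhs_mpval (V := [set x | (x < (r - b)%:E)%E])).
  by apply: open_nbhs_nbhs; split=> //; exact: open_ereal_lt_ereal.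
have near2 : nbhs B [set B' : 'M[T]_n | mpfin (r - a) <+ B' i j].
  apply: (nbhs_coord (V := [set x | mpfin (r - a) <+ x])).
  apply: (nbhs_mpval (V := [set x | ((r - a)%:E < x)%E])).
  by apply: open_nbhs_nbhs; split=> //; exact: open_ereal_gt_ereal.
apply: filterS2 near1 near2 => B' lo hi.
apply: (@mplt_le_trans _ (mpfin r)); last first.
  have := mpleM (mplexx (mpfin a)) (mpltW hi).
  by rewrite -mpfinD addrC subrK.
have := mpltM lo (mplexx _) (mpfin_neq0 b).
by rewrite -mpfinD subrK mulrC.
Qed.

Lemma proj_classP A B : proj_class A = proj_class B <-> exists l : R, B = mpfin l *: A.
Proof.
split=> [/eqquotP/asboolP//|AB]; apply/eqquotP; exact/asboolP.
Qed.

Lemma proj_class_eq0 A : proj_class A = proj_class (0 : 'M[T]_n) -> A = 0.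
Proof. by move=> /esym/proj_classP[l ->]; rewrite scaler0. Qed.

(** The classes outside a closed set of matrices stable under scaling form an open
    set. *)
Lemma closure_proj_inv (S : set (projmx R n)) (Z : set 'M[T]_n) B :
  (forall A, S (proj_class A) -> Z A) ->
  (forall (a : R) A, Z A -> Z (mpfin a *: A)) -> closed Z ->
  closure S (proj_class B) -> B != 0 -> Z B.
Proof.
move=> SZ Zscale Zclosed SB B0; apply: contrapT => nZB.
pose U := [set c | exists2 A, ~ Z A & c = proj_class A].
have UE A : U (proj_class A) <-> ~ Z A.
  split=> [[A' nZA' /proj_classP[l AE]]|nZA]; last by exists A.
  by apply: contra_not nZA' => /(Zscale l); rewrite -AE.
have oU : open U.
  rewrite -[open U]/(open [set A : 'M[T]_n | A != 0 /\ U (proj_class A)]).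
  have := openI (@nonnull_open R n) (closed_openC Zclosed).
  by congr open; apply/seteqP; split=> A [? ?]; split=> //; apply/UE.
have [c [Sc Uc]] := SB U (open_nbhs_nbhs (conj oU ((UE B).2 nZB))).
by have [A nZA cE] := Uc; apply: nZA; apply: SZ; rewrite -cE.
Qed.

Lemma closure_proj_null (S : set (projmx R n)) :
  closure S (proj_class (0 : 'M[T]_n)) -> S (proj_class 0).
Proof.
pose U := [set c | c = proj_class (0 : 'M[T]_n)].
have oU : open U.
  rewrite -[open U]/(open [set A : 'M[T]_n | A != 0 /\ U (proj_class A)]).
  rewrite (_ : mkset _ = set0); first exact: open0.
  by apply/seteqP; split=> // A [/eqP A0 /proj_class_eq0].
by move=> /(_ U (open_nbhs_nbhs (conj oU erefl)))[c [Sc <-]].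
Qed.

Lemma closure_proj_limit (S : set (projmx R n)) (B : 'M[T]_n) (A : nat -> 'M[T]_n) :
  (forall m, S (proj_class (A m))) -> B != 0 ->
  (forall V : 'I_n -> 'I_n -> set T, (forall i j, nbhs (B i j) (V i j)) ->
    exists m, forall i j, V i j (A m i j)) ->
  closure S (proj_class B).
Proof.
move=> SA B0 lim U; rewrite nbhsE => -[O [oO OB] OU].
have : nbhs B [set A : 'M[T]_n | A != 0 /\ O (proj_class A)] by exact: open_nbhs_nbhs.
move=> [V BV VO]; have [k Ak] := lim V BV; exists (proj_class (A k)); split=> //.
by have [_ /OU] := VO _ Ak.
Qed.

End Topology.

(** * The critical graph *)

Section CriticalGraph.
Context {R : realType} {n : nat}.
Local Notation T := (maxplus R).
Implicit Types (A : 'M[T]_n) (i j : 'I_n).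

Lemma cycle_arcs (e : rel 'I_n) c : c != [::] ->
  (forall a, a \in circuit_arcs c -> e a.1 a.2) -> path.cycle e c.
Proof.
case: c => // i p _; rewrite /circuit_arcs rot1_cons /=.
elim: p {1 3}i => [|k p IH] j /= ec.
  by rewrite andbT; apply: (ec (j, i)); rewrite mem_head.
apply/andP; split; first by apply: (ec (j, k)); rewrite mem_head.
by apply: IH => a ap; apply: ec; rewrite inE ap orbT.
Qed.

Lemma critical_cycle A c : critical A c -> path.cycle (crit_arc A) c.
Proof.
move=> cc; have /andP[/andP[c0 _] _] := cc; apply: cycle_arcs => // -[i j] ijc.
by apply/asboolP; exists c.
Qed.

Lemma circuit_arcs_mem c i j : (i, j) \in circuit_arcs c -> i \in c /\ j \in c.
Proof.
move=> ijc; split.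
  by move/(map_f fst): ijc; rewrite -/(unzip1 _) unzip1_zip ?size_rot.
by move/(map_f snd): ijc; rewrite -/(unzip2 _) unzip2_zip ?size_rot// mem_rot.
Qed.

Lemma crit_arc_back A i j : crit_arc A i j -> connect (crit_arc A) j i.
Proof.
move=> /asboolP[c cc /circuit_arcs_mem[ic jc]].
exact: (connect_cycle (critical_cycle cc)).
Qed.

Lemma crit_nodeE A : crit_node A = finset (node (crit_arc A)).
Proof.
apply/setP => i; rewrite !inE; apply/asboolP/existsP => [[c cc ic]|[j /asboolP[c cc]]].
  by exists (next c i); apply: next_cycle (critical_cycle cc) ic.
by move=> /circuit_arcs_mem[ic _]; exists c.
Qed.

Lemma crit_node_exists A lam : rho A = lam%:E -> exists i, node (crit_arc A) i.
Proof.
move=> rhoA; have [|[c [c0 _ cE]]] := rho_attained A; first by rewrite rhoA.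
have cc : critical A c.
  rewrite /critical -cE eqxx andbT /circuit c0 /= -circuit_weight_neq0//.
  by apply/eqP => /(mean_weight_null c0) cw; rewrite cw rhoA in cE.
case: c c0 cc {cE} => // i c _ cc; exists i.
have : i \in crit_node A by rewrite inE; apply/asboolP; exists (i :: c); rewrite ?mem_head.
by rewrite crit_nodeE inE.
Qed.

Lemma rho_neqy A : rho A != +oo%E.
Proof.
have [->//|[c [c0 _ ->]]] := rho_attained A.
case: (maxplusP (circuit_weight A c)) => [cw|w cw].
  by rewrite (mean_weight_null c0 cw).
by rewrite (mean_weight_fin c0 cw).
Qed.

(** A walk of length n contains a circuit. *)
Lemma acyclic_nilpotent A : rho A = -oo%E -> A ^+ n = 0.
Proof.
move=> rhoA; apply/matrixP => i j; rewrite mxE; apply/eqP; apply: contraT.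
move=> /[dup] An /pow_path[p [sp _ pE]]; have [q1 [q2 [q3 [pq q20 q2l]]]] := path_loop i sp.
have [c [c0 cs cE]] := loop_circuit A q20 q2l.
have cw : circuit_weight A c != 0.
  rewrite -cE; move: An; rewrite -pE pq !path_weight_cat !mpmul_eq0 !negb_or.
  by case/and3P.
have cn : (size c <= n)%N.
  by apply: leq_trans (eq_leq sp); rewrite cs pq !size_cat addnCA leq_addr.
have := mean_weight_le_rho A c0 cn; rewrite rhoA.
case: (maxplusP (circuit_weight A c)) cw => [->|w wE _]; first by rewrite eqxx.
by rewrite (mean_weight_fin c0 wE).
Qed.

Lemma critical_weight A c : critical A c -> exists w, circuit_weight A c = mpfin w.
Proof.
move=> /andP[/andP[c0 cc] _].
case: (maxplusP (circuit_weight A c)) => [/eqP|w ->]; last by exists w.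
rewrite -[_ == 0]negbK circuit_weight_neq0//; by rewrite cc.
Qed.

Lemma acyclic_node A i : rho A = -oo%E -> ~~ node (crit_arc A) i.
Proof.
move=> rhoA; apply/existsPn => j; apply/asboolP => -[c cc _].
have [w wE] := critical_weight cc.
have /andP[/andP[c0 _] /eqP] := cc; rewrite (mean_weight_fin c0 wE) rhoA.
by [].
Qed.

End CriticalGraph.

(** * Bounds common to all ranks *)

Section RankBounds.
Context {R : realType}.
Local Notation T := (maxplus R).

(** A dominant submatrix and its transpose bound the tropical and Gondran-Minoux ranks.
    The tropical rank bounds the symmetrized and Kapranov ranks, and through the
    symmetrized rank also the Schein rank and the row and column ranks. *)
Lemma rk_ge_dominant m n (B : 'M[T]_(m, n)) r (f : 'I_r -> 'I_m) (g : 'I_r -> 'I_n) star :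
  dominant B f g -> (r <= rk star B)%N.
Proof.
move=> domB; have trop := dominant_tropical domB.
have tropT := dominant_tropical (dominant_tr domB).
have schein := leq_trans (tropical_le_symmetrized B) (symmetrized_le_schein B).
have scheinT := leq_trans (tropical_le_symmetrized B^T) (symmetrized_le_schein B^T).
case: star => /=.
- exact: trop.
- exact: leq_trans trop (tropical_le_symmetrized B).
- exact: dominant_gm domB.
- exact: dominant_gm (dominant_tr domB).
- exact: leq_trans trop (tropical_le_kapranov B).
- exact: leq_trans trop schein.
- exact: leq_trans trop (leq_trans schein (schein_le_row_rank B)).
- exact: leq_trans tropT (leq_trans scheinT (schein_le_row_rank B^T)).
Qed.

Lemma rk_le_row_column m n (B : 'M[T]_(m, n)) r star :
  (row_rank B <= r)%N -> (column_rank B <= r)%N -> (rk star B <= r)%N.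
Proof.
move=> rowB colB; have schein := leq_trans (schein_le_row_rank B) rowB.
case: star => //=; apply: leq_trans schein.
- exact: leq_trans (tropical_le_symmetrized B) (symmetrized_le_schein B).
- exact: symmetrized_le_schein.
- exact: gm_row_le_schein.
- exact: gm_column_le_schein.
- exact: kapranov_le_schein.
Qed.

(** Such a factorisation expresses the rows of B as combinations of the rows of index in
    X, and likewise for its columns. *)
Lemma rk_le_factor n (B : 'M[T]_n) (X : {set 'I_n}) star :
  (forall i j, B i j = \sum_(x in X) B i x * B x j) -> (rk star B <= #|X|)%N.
Proof.
move=> BX; apply: rk_le_row_column; apply: row_rank_le => i.
  exists (B i); apply/rowP => j; rewrite mxE summxE BX.
  by apply: eq_bigr => x _; rewrite !mxE.
exists (fun x => B x i); apply/rowP => j; rewrite !mxE summxE BX.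
by apply: eq_bigr => x _; rewrite !mxE mulrC.
Qed.

End RankBounds.

(** * Powers and limit points of a cyclic matrix *)

Section UltimateRank.
Context {R : realType} {n : nat}.
Local Notation T := (maxplus R).
Implicit Types (i j : 'I_n).
Variables (A : 'M[T]_n) (lam : R).
Hypothesis rhoA : rho A = lam%:E.
Let e := crit_arc A.
Let back := @crit_arc_back R n A.
Context (p : 'I_n -> R) (eps : R) (eps0 : 0 < eps).
Hypothesis strict : forall i j,
  if crit_arc A i j then A i j = mpfin (lam + (p i - p j))
  else A i j <=+ mpfin (lam + (p i - p j) - eps).
Context (L : nat) (L0 : (0 < L)%N) (Lwalk : forall i, node e i -> walk e L i i).

Let W : 'M[T]_n := \matrix_(i, j) (mpfin (p j - p i - lam) * A i j).
Let X := reps e L.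

Let vis i j : if e i j then W i j = 1 else W i j <=+ mpfin (- eps).
Proof.
have := strict i j; rewrite mxE /e; case: ifP => _.
  by move=> ->; rewrite -mpfinD -mpfin0; congr mpfin; lra.
move=> /(mpleM (mplexx (mpfin (p j - p i - lam))))/mple_trans; apply.
by rewrite -mpfinD mple_fin; lra.
Qed.

Lemma conj_pow t i j : (A ^+ t) i j = mpfin (lam *+ t + (p i - p j)) * (W ^+ t) i j.
Proof.
elim: t i => [|t IH] i.
  rewrite !pow0; have [->|] := eqVneq i j; last by rewrite mulr0.
  by rewrite mulr1 mulr0n subrr addr0.
rewrite !powS mulr_sumr; apply: eq_bigr => l _.
rewrite IH mxE !mulrA; congr (_ * _); rewrite -mpfinD [LHS]mulrC.
by congr (mpfin _ * _); rewrite mulrS; lra.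
Qed.

Lemma crit_pow_neq0 t : A ^+ t != 0.
Proof.
have [i Ni] := crit_node_exists rhoA.
have [j ij] := node_walk_all back t Ni.
apply/eqP => /matrixP/(_ i j); rewrite mxE conj_pow (vis_pow_walk eps0 vis ij) mulr1.
by move=> /eqP; apply/negP.
Qed.

Let P := spectral_projector e W L.
Definition limit_projector : 'M[T]_n := \matrix_(i, j) (mpfin (p i - p j) * P i j).

Lemma limit_projectorE i j : limit_projector i j = mpfin (p i - p j) * P i j.
Proof. by rewrite mxE. Qed.

Lemma limit_projector_rk star : (rk star limit_projector <= #|X|)%N.
Proof.
apply: rk_le_factor => i j; rewrite limit_projectorE /P.
rewrite (projector_reps eps0 vis back L0 Lwalk) mulr_sumr; apply: eq_bigr => x _.
rewrite !limit_projectorE mulrACA -mpfinD; congr (mpfin _ * _); lra.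
Qed.

Lemma limit_projector_closure : closure (proj_semigroup A) (proj_class limit_projector).
Proof.
pose B k : 'M[T]_n := \matrix_(i, j) (mpfin (p i - p j) * (W ^+ (L * k.+1)) i j).
have BE k i j : B k i j = mpfin (p i - p j) * (W ^+ (L * k.+1)) i j by rewrite mxE.
have [c Nc] := crit_node_exists rhoA.
apply: (closure_proj_limit (A := B)) => [k||V PV].
- exists (L * k.+1)%N; first by rewrite /= muln_gt0 L0.
  apply/esym/proj_classP; exists (lam *+ (L * k.+1)).
  by apply/matrixP => i j; rewrite mxE BE conj_pow mulrA -mpfinD.
- apply/eqP => /matrixP/(_ c c); rewrite limit_projectorE subrr mul1r /P.
  by rewrite (projector_diag eps0 vis Lwalk Nc) [RHS]mxE => /eqP; apply/negP.
have ev i j : exists K, forall k, (K <= k)%N -> V i j (B k i j).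
  have [U PU UV] := nbhs_mpval_ex (PV i j).
  suff [K KP] : exists K, forall k, (K <= k)%N -> U (B k i j).
    by exists K => k Kk; apply/UV/KP.
  have lo k : (n + n <= k)%N -> limit_projector i j <=+ B k i j.
    move=> nk; rewrite limit_projectorE BE; apply: mpleM => //.
    by apply: (projector_le_pow eps0 vis Lwalk); exact: leqW.
  have hi k : B k i j <=+ mpfin (p i - p j - eps *+ k.+1) + limit_projector i j.
    rewrite limit_projectorE BE (mpfinD (p i - p j)) -mulrDr; apply: mpleM => //.
    exact: (pow_le_projector eps0 vis back L0 Lwalk).
  (* a null entry is a limit of entries tending to - oo, and a finite one is
     reached as soon as eps * k.+1 exceeds the gap *)
  case: (maxplusP (limit_projector i j)) => [P0|r Pr].
    rewrite P0 in PU hi; have [M [_ MU]] := PU.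
    exists (Num.truncn ((p i - p j - M) / eps)) => k Kk; apply: MU.
    apply: (@mple_lt_trans _ _ (B k i j) (mpfin M) (hi k)); rewrite addr0.
    rewrite mplt_fin ltrBlDr -ltrBlDl -mulr_natl.
    rewrite -ltr_pdivrMr//; apply: lt_le_trans (truncnS_gt _) _.
    by rewrite ler_nat ltnS.
  exists (maxn (n + n) (Num.truncn ((p i - p j - r) / eps)))%N => k.
  rewrite geq_max => /andP[nk Kk].
  suff -> : B k i j = limit_projector i j by exact: nbhs_singleton.
  apply: mple_anti; last exact: lo.
  apply: mple_trans (hi k) _; rewrite mple_add mplexx andbT Pr mple_fin lerBlDr -lerBlDl.
  rewrite -mulr_natl -ler_pdivrMr//; apply: le_trans (ltW (truncnS_gt _)) _.
  by rewrite ler_nat ltnS.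
have /choice[K KP] : forall q : 'I_n * 'I_n, exists K,
    forall k, (K <= k)%N -> V q.1 q.2 (B k q.1 q.2).
  by move=> q; exact: ev.
exists (\max_(q : 'I_n * 'I_n) K q)%N => i j; apply: (KP (i, j)).
exact: (@leq_bigmax _ K (i, j)).
Qed.

Let basic a i j b k l := [set B : 'M[T]_n | mpfin a * B i j <=+ mpfin b * B k l].

Let closed_basic a i j b k l : closed (basic a i j b k l).
Proof.
rewrite -[basic _ _ _ _ _ _]setCK; apply: open_closedC; rewrite openE => B.
move=> /negP; rewrite -mpltNge => /near_mple_fin; apply: filterS => B'.
by rewrite /= mpltNge => /negP.
Qed.

(** In terms of the normalised entries u x y = B x y - p x + p y, and for x, x', x''
    in X: u x (Y x') + eps <= u x'' (Y x'') if x <> x', and every entry of u is at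
    most u x (Y x). Only differences of two entries are
    bounded, which makes these conditions closed and invariant under scaling. *)
Definition dominated (Y : {ffun 'I_n -> 'I_n}) : set 'M[T]_n :=
  (\bigcap_(q in [set q : 'I_n * 'I_n * 'I_n |
      [/\ q.1.1 \in X, q.1.2 \in X, q.2 \in X & q.1.1 != q.1.2]])
    basic (p (Y q.1.2) - p q.1.1 + eps) q.1.1 (Y q.1.2)
          (p (Y q.2) - p q.2) q.2 (Y q.2)) `&`
  (\bigcap_(q in [set q : 'I_n * 'I_n * 'I_n | q.2 \in X])
    basic (p q.1.2 - p q.1.1) q.1.1 q.1.2 (p (Y q.2) - p q.2) q.2 (Y q.2)).

Definition some_dominated : set 'M[T]_n := \bigcup_(Y in setT) dominated Y.

Lemma closed_some_dominated : closed some_dominated.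
Proof.
apply: closed_bigcup => [|Y _]; first exact: finite_finset.
by apply: closedI; apply: closed_bigI => q _; exact: closed_basic.
Qed.

Lemma some_dominated_scale (a : R) B : some_dominated B -> some_dominated (mpfin a *: B).
Proof.
move=> [Y _ [Y1 Y2]]; exists Y => //; split=> q qD; rewrite /basic /= !mxE.
  by rewrite ![_ * (mpfin a * _)]mulrCA mple_mulfin; exact: Y1.
by rewrite ![_ * (mpfin a * _)]mulrCA mple_mulfin; exact: Y2.
Qed.

(** Take for Y x the end of a critical walk of length t starting from x. If some critical
    walk of length t joined x to Y x' then x and x' would be joined by a critical walk
    of length divisible by L, so they would be equal. *)
Lemma pow_dominated t : some_dominated (A ^+ t).
Proof.
have /choice[y yP] : forall x, exists y, x \in X -> walk e t x y.
  move=> x; have [xX|_] := boolP (x \in X); last by exists x.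
  have [y xy] := node_walk_all back t (reps_node back xX); by exists y.
exists (finfun y) => //; split=> -[[x x'] x''] /=.
  move=> [xX x'X x''X xx']; rewrite /basic /= !ffunE !conj_pow.
  rewrite (vis_pow_walk eps0 vis (yP _ x''X)) mulr1 mulrA -!mpfinD.
  have := vis_pow eps0 vis t x (y x'); case: ifP => [xy'|_ le].
    case/eqP: xx'; apply: (reps_sep back L0 xX x'X).
    have m1 : mwalk e L t x (y x') by exists t.
    have m2 : mwalk e L t x' (y x') by exists t => //; exact: yP.
    apply: mwalk_eq (mwalk_trans m1 (mwalk_return back L0 m2)).
    by rewrite -mulSn prednK// modnMr mod0n.
  apply: mple_trans (mpleM (mplexx _) le) _; rewrite -mpfinD mple_fin; lra.
move=> x''X; rewrite /basic /= !ffunE !conj_pow.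
rewrite (vis_pow_walk eps0 vis (yP _ x''X)) mulr1 mulrA -!mpfinD.
apply: mple_trans (mpleM (mplexx _) (vis_pow_le1 eps0 vis t x x')) _.
rewrite mulr1 mple_fin; lra.
Qed.

(** The normalised entries at the positions x, Y x bound all the others, so they are
    equal to each other, and finite as B is not null. Those at the positions x, Y x'
    are smaller by eps. *)
Lemma dominated_rk B star : some_dominated B -> B != 0 -> (#|X| <= rk star B)%N.
Proof.
move=> [Y _ [Y1 Y2]] B0.
pose f (k : 'I_#|X|) : 'I_n := enum_val k.
pose g k := Y (f k).
have fX k : f k \in X by exact: enum_valP.
have [[i0 j0] B00] : exists q : 'I_n * 'I_n, B q.1 q.2 != 0.
  apply: contrapT => /forallNP nB; case/eqP: B0; apply/matrixP => i j.
  by rewrite mxE; apply/eqP; apply: contrapT => /negP; exact: (nB (i, j)).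
pose u k := mpfin (p (g k) - p (f k)) * B (f k) (g k).
have u0 k : u k != 0.
  have := Y2 (i0, j0, f k) (fX k); rewrite /basic /= -/(g k) -/(u k).
  by apply: contraTneq => ->; rewrite -mpltNge mplt0 mpmul_eq0 negb_or B00.
have uE k l : u k = u l.
  apply: mple_anti; first exact: (Y2 (f k, g k, f l) (fX l)).
  exact: (Y2 (f l, g l, f k) (fX k)).
apply: (rk_ge_dominant (f := f) (g := g)).
have [a aP] : exists a : R, forall k, u k = mpfin a.
  have [k0|no] := pselect (exists k : 'I_#|X|, True); last first.
    by exists 0 => k; case: no; exists k.
  have [k _] := k0; case: (maxplusP (u k)) => [uk|a uk]; last first.
    by exists a => l; rewrite (uE l k).
  by have := u0 k; rewrite uk eqxx.
exists (fun k => a + p (f k)), (fun k => - p (g k)) => k l.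
case: eqP => [<-|/eqP kl].
  have := aP k; rewrite /u; case: (maxplusP (B (f k) (g k))) => [->|b ->].
    by rewrite mulr0 => /esym/eqP; rewrite (negPf (mpfin_neq0 _)).
  by rewrite -mpfinD => /mpfin_inj <-; congr mpfin; lra.
have fkl : f k != f l by rewrite (inj_eq enum_val_inj).
have := Y1 (f k, f l, f k) (And4 (fX k) (fX l) (fX k) fkl).
rewrite /basic /= -/(g k) -/(g l) -/(u k) aP.
case: (maxplusP (B (f k) (g l))) => [->|b ->]; first by rewrite mplt0.
by rewrite -!mpfinD mple_fin mplt_fin => le; have := eps0; lra.
Qed.

Lemma rk_closure_ge B star :
  closure (proj_semigroup A) (proj_class B) -> (#|X| <= rk star B)%N.
Proof.
move=> clB; have [B0|B0] := eqVneq B 0.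
  move: clB; rewrite B0 => /closure_proj_null[k _ /proj_class_eq0 Ak0].
  by have := crit_pow_neq0 k; rewrite Ak0 eqxx.
apply: dominated_rk => //.
apply: closure_proj_inv clB B0; [|exact: some_dominated_scale|exact: closed_some_dominated].
move=> A' [k _ /proj_classP[a ->]]; apply: some_dominated_scale; exact: pow_dominated.
Qed.

End UltimateRank.

Theorem theorem5p2 (R : realType) (n : nat) (n_ge1 : (1 <= n)%N)
    (A : 'M[maxplus R]_n) :
  exists urk : nat,
    (forall star : rank_notion,
       is_min [set rk star B | B in
                [set B : 'M[maxplus R]_n | closure (proj_semigroup A) (proj_class B)]]
         urk) /\
    urk = (\sum_(C in crit_components A) cyclicity (crit_arc A) C)%N.
Proof.
exists (\sum_(C in crit_components A) cyclicity (crit_arc A) C)%N; split=> // star.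
have [L L0 Lwalk] := common_period (@crit_arc_back R n A).
rewrite /crit_components crit_nodeE -(card_reps (@crit_arc_back R n A) L0 Lwalk).
case rhoA: (rho A) => [lam| |]; last first.
- have A0 : closure (proj_semigroup A) (proj_class (0 : 'M[maxplus R]_n)).
    by apply: subset_closure; exists n; rewrite // acyclic_nilpotent.
  have X0 : reps (crit_arc A) L = finset pred0.
    apply/setP => x; rewrite inE; apply/negP => /(reps_node (@crit_arc_back R n A)).
    by apply/negP; exact: acyclic_node.
  have -> : #|reps (crit_arc A) L| = 0%N by rewrite X0; apply: eq_card0 => x; rewrite inE.
  split=> //; exists 0 => //; apply/eqP; rewrite -leqn0.
  have c0 : #|finset (pred0 : pred 'I_n)| = 0%N by apply: eq_card0 => x; rewrite inE.
  rewrite -c0; apply: rk_le_factor => i j; rewrite mxE big1// => x _.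
  by rewrite mxE mul0r.
- by have := rho_neqy A; rewrite rhoA.
have [p [eps [eps0 strict]]] := strict_visualisation rhoA.
have lower B : closure (proj_semigroup A) (proj_class B) ->
    (#|reps (crit_arc A) L| <= rk star B)%N.
  move=> clB; exact: (rk_closure_ge rhoA eps0 strict L0 star clB).
split=> [|_ [B clB <-]]; last exact: lower.
have clP := limit_projector_closure rhoA eps0 strict L0 Lwalk.
exists (limit_projector A lam p L) => //; apply/eqP; rewrite eqn_leq lower// andbT.
exact: (limit_projector_rk eps0 strict L0 Lwalk star).
Qed.
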